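(* Let $d,n,n_{\mathsf{MC}}\ge1$ be integers, $\sigma>0$, $\mu_1,\dots,\mu_n\in\mathbb{R}^d$, and let $g(t)=\frac1n\sum_{i=1}^n\varphi_\sigma(t-\mu_i)$ be the corresponding Gaussian mixture density. Let $C\sim\mathsf{Unif}(\{\mu_i\}_{i=1}^n)$ (each index $i$ having probability $1/n$). Let $Z_j^{(i)}$, $1\le i\le n$, $1\le j\le n_{\mathsf{MC}}$, be i.i.d. with density $\varphi_\sigma$ and define $$\hat h_{\mathsf{MC}}=-\frac1n\sum_{i=1}^n\frac1{n_{\mathsf{MC}}}\sum_{j=1}^{n_{\mathsf{MC}}}\log g\big(\mu_i+Z_j^{(i)}\big),\qquad \mathsf{MSE}(\hat h_{\mathsf{MC}})=\mathbb{E}\Big[\big(\hat h_{\mathsf{MC}}-h(g)\big)^2\Big].$$ (i) If $C\in[-1,1]^d$ almost surely, then $$\mathsf{MSE}(\hat h_{\mathsf{MC}})\le\frac{2d(2+\sigma^2)}{\sigma^2}\,\frac1{n\cdot n_{\mathsf{MC}}}.$$ (ii) If $m:=\mathbb{E}\|C\|_2^2<\infty$, then $$\mathsf{MSE}(\hat h_{\mathsf{MC}})\le\frac{9d\sigma^2+8(2+\sigma\sqrt d)m+3(11\sigma\sqrt d+1)\sqrt m}{\sigma^2}\,\frac1{n\cdot n_{\mathsf{MC}}}.$$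
   Context: $\varphi_\sigma$ is the density of $\mathcal{N}(0,\sigma^2\mathrm{I}_d)$; $h(g)=-\int g\log g$ is the differential entropy with natural logarithm. *)

(* Defs.v *)
From HB Require Import structures.
From mathcomp Require Import all_boot all_order all_algebra.
From mathcomp Require Import all_classical all_reals all_analysis.

Set Implicit Arguments.
Unset Strict Implicit.
Unset Printing Implicit Defensive.

Import Order.TTheory GRing.Theory Num.Theory.
Import numFieldNormedType.Exports.

Local Open Scope classical_set_scope.
Local Open Scope ring_scope.

(* R^d is [d.-tuple R]: the library equips tuples with the sigma-algebra
   generated by the coordinate maps, i.e. the Borel sigma-algebra of R^d. *)

Section euclidean.
Context {R : realType} {d : nat}.
Implicit Types x y : d.-tuple R.

Definition vadd x y : d.-tuple R := [tuple tnth x k + tnth y k | k < d].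

Definition vsub x y : d.-tuple R := [tuple tnth x k - tnth y k | k < d].

Definition norm2 x : R := Num.sqrt (\sum_(k < d) tnth x k ^+ 2).

End euclidean.

Definition tuple_cons {R : realType} {d : nat}
  (p : measurableTypeR R * d.-tuple R) : d.+1.-tuple R := [tuple of p.1 :: p.2].

(* Lebesgue measure on R^d: iterated product with the one-dimensional Lebesgue
   measure, transported along R * R^d ~ R^(d+1). *)
Fixpoint lebesgue_vec {R : realType} (d : nat) : set (d.-tuple R) -> \bar R :=
  match d return set (d.-tuple R) -> \bar R with
  | 0%N => \d_([tuple] : 0.-tuple R)
  | d'.+1 =>
      pushforward (product_measure1 lebesgue_measure (@lebesgue_vec R d'))
        tuple_cons
  end.

Section lebesgue_vec_measure.
Context {R : realType}.

Let sfm d := {sigma_finite_measure set (d.-tuple R) -> \bar R}.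

Let measurable_tuple_cons d : measurable_fun setT (@tuple_cons R d).
Proof.
exact: (@measurable_cons _ _ (measurableTypeR R * d.-tuple R)%type R fst d snd).
Qed.

Let tuple_consK d (p : measurableTypeR R * d.-tuple R) :
  (thead (tuple_cons p), [tuple of behead (tuple_cons p)]) = p.
Proof. by case: p => x t /=; congr (_, _); apply/val_inj. Qed.

Section step.
Variables (d : nat) (m : sfm d).

Let prod : {measure set (measurableTypeR R * d.-tuple R)%type -> \bar R} :=
  product_measure1 lebesgue_measure m.

Let step : set (d.+1.-tuple R) -> \bar R := pushforward prod (@tuple_cons R d).

Let step0 : step set0 = 0%E.
Proof. by rewrite /step /pushforward preimage_set0 measure0. Qed.

Let step_ge0 A : (0 <= step A)%E.
Proof. exact: (measure_ge0 prod). Qed.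

Let mpre A : measurable A -> measurable (@tuple_cons R d @^-1` A).
Proof.
by move=> mA; rewrite -[X in measurable X]setTI; exact: measurable_tuple_cons.
Qed.

Let step_sigma_additive : semi_sigma_additive step.
Proof.
move=> F mF tF mUF; rewrite /step /pushforward preimage_bigcup.
apply: measure_semi_sigma_additive.
- by move=> n; exact: mpre.
- apply/trivIsetP => /= i j _ _ ij; rewrite -preimage_setI.
  by move/trivIsetP : tF => /(_ _ _ _ _ ij) ->//; rewrite preimage_set0.
- by rewrite -preimage_bigcup; exact: mpre.
Qed.

HB.instance Definition _ := isMeasure.Build _ _ _ step
  step0 step_ge0 step_sigma_additive.

Let uncons (t : d.+1.-tuple R) : measurableTypeR R * d.-tuple R :=
  (thead t, [tuple of behead t]).

Let measurable_uncons : measurable_fun setT uncons.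
Proof.
apply: measurable_fun_pair; last exact: measurable_behead.
exact: (measurable_tnth ord0).
Qed.

Let step_sigma_finite : sigma_finite setT step.
Proof.
have /sigma_finiteP[F [TF ndF Foo]] := sigma_finiteT (@lebesgue_measure R).
have /sigma_finiteP[G [TG ndG Goo]] := sigma_finiteT m.
exists (fun k => uncons @^-1` (F k `*` G k)).
  rewrite -preimage_bigcup -(preimage_setT uncons); congr (_ @^-1` _).
  rewrite -setXTT TF TG predeqE => -[x y]; split.
    move=> [/= [k _ Fkx] [l _ Gly]]; exists (maxn k l) => //; split.
    - by move: x Fkx; exact/subsetPset/ndF/leq_maxl.
    - by move: y Gly; exact/subsetPset/ndG/leq_maxr.
  by move=> [k _ []/= ? ?]; split; exists k.
move=> k; have [mF Fk] := Foo k; have [mG Gk] := Goo k; split.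
  rewrite -[X in measurable X]setTI; apply: measurable_uncons => //.
  exact: measurableX.
rewrite /step /pushforward (_ : _ @^-1` _ = F k `*` G k).
  rewrite (_ : prod _ = (lebesgue_measure (F k) * m (G k))%E); last first.
    exact: product_measure1E.
  by rewrite lte_mul_pinfty// ge0_fin_numE.
by apply/funext => p; exact: (congr1 (F k `*` G k) (tuple_consK p)).
Qed.

HB.instance Definition _ := Measure_isSigmaFinite.Build _ _ _ step
  step_sigma_finite.

Lemma lebesgue_vec_step : exists m' : sfm d.+1, step = m' :> (set _ -> _).
Proof. by exists step. Qed.

End step.

Lemma lebesgue_vec_sfm d : exists m : sfm d, @lebesgue_vec R d = m :> (set _ -> _).
Proof.
elim: d => [|d [m mE]] /=; last by rewrite mE; exact: lebesgue_vec_step.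
by exists (\d_([tuple] : 0.-tuple R)).
Qed.

Variable d : nat.

Let lv := @lebesgue_vec R d.

Let lv0 : lv set0 = 0%E.
Proof. by have [m mE] := lebesgue_vec_sfm d; rewrite /lv mE measure0. Qed.

Let lv_ge0 A : (0 <= lv A)%E.
Proof. by have [m mE] := lebesgue_vec_sfm d; rewrite /lv mE measure_ge0. Qed.

Let lv_sigma_additive : semi_sigma_additive lv.
Proof.
have [m mE] := lebesgue_vec_sfm d; rewrite /lv mE.
exact: measure_semi_sigma_additive.
Qed.

HB.instance Definition _ := isMeasure.Build _ _ _ (@lebesgue_vec R d)
  lv0 lv_ge0 lv_sigma_additive.

Let lv_sigma_finite : sigma_finite setT (@lebesgue_vec R d).
Proof.
have [m mE] := lebesgue_vec_sfm d; rewrite mE; exact: sigma_finiteT.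
Qed.

HB.instance Definition _ := Measure_isSigmaFinite.Build _ _ _
  (@lebesgue_vec R d) lv_sigma_finite.

End lebesgue_vec_measure.

Lemma lebesgue_vec_box (R : realType) (d : nat) (A : 'I_d -> set R) :
  (forall k, measurable (A k)) ->
  @lebesgue_vec R d [set t | forall k, A k (tnth t k)] =
  (\prod_(k < d) lebesgue_measure (A k))%E.
Proof.
elim: d A => [A _|d ih A mA] /=.
  by rewrite big_ord0 diracE mem_set//= => -[].
rewrite big_ord_recl -ih; last by move=> k; exact: mA.
rewrite /pushforward.
rewrite (_ : _ @^-1` _ =
    A ord0 `*` [set t : d.-tuple R | forall k, A (lift ord0 k) (tnth t k)]).
  rewrite product_measure1E//; first exact: mA.
  rewrite (_ : [set _ | _] =
    \bigcap_(k in [set: 'I_d]) ((fun t : d.-tuple R => tnth t k) @^-1` A (lift ord0 k))).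
    apply: fin_bigcap_measurable => // k _.
    by rewrite -[X in measurable X]setTI; apply: measurable_tnth => //; exact: mA.
  by apply/seteqP; split => t /= h k; [move=> _; exact: h|exact: (h k I)].
apply/seteqP; split => -[x t] /=.
  move=> h; split; first exact: (h ord0).
  by move=> k; have := h (lift ord0 k); rewrite /tuple_cons tnthS.
move=> [h0 h] k; have [j ->|->//] := unliftP ord0 k.
by rewrite /tuple_cons tnthS; exact: h.
Qed.

Section gaussian_mixture.
Context {R : realType} {d : nat}.

Definition gauss_pdf (sigma : R) (t : d.-tuple R) : R :=
  (2 * pi * sigma ^+ 2) `^ (- (d%:R / 2)) *
  expR (- (norm2 t ^+ 2 / (2 * sigma ^+ 2))).

Definition mixture_pdf (n : nat) (sigma : R) (mu : 'I_n -> d.-tuple R)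
    (t : d.-tuple R) : R :=
  n%:R^-1 * \sum_(i < n) gauss_pdf sigma (vsub t (mu i)).

(* [ln 0 = 0] in the library, which gives the convention 0 log 0 = 0.  The
   value is kept in [\bar R] so that no finiteness is built in. *)
Definition diff_entropy (g : d.-tuple R -> R) : \bar R :=
  (- \int[@lebesgue_vec R d]_t (g t * ln (g t))%:E)%E.

Definition mc_entropy (n nMC : nat) (sigma : R) (mu : 'I_n -> d.-tuple R)
    (z : 'I_n -> 'I_nMC -> d.-tuple R) : R :=
  - (n%:R^-1 * \sum_(i < n) (nMC%:R^-1 *
      \sum_(j < nMC) ln (mixture_pdf sigma mu (vadd (mu i) (z i j))))).

End gaussian_mixture.

Section random_vectors.
Context {dT dT' : measure_display} {T : measurableType dT}
  {T' : measurableType dT'} {R : realType} (P : probability T R).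

Definition mutually_independent (I : finType) (X : I -> {RV P >-> T'}) : Prop :=
  forall (J : {set I}) (A : I -> set T'), (forall i, measurable (A i)) ->
    P (\bigcap_(i in [set` J]) (X i @^-1` A i)) =
    (\prod_(i in J) P (X i @^-1` A i))%E.

(* ['E_P] only takes real-valued maps; its defining integral is used here since
   [theta] is extended-real. *)
Definition MSE (est : T -> R) (theta : \bar R) : \bar R :=
  (\int[P]_w (((est w)%:E - theta) ^+ 2))%E.

End random_vectors.

Section laws.
Context {dT : measure_display} {T : measurableType dT} {R : realType}
  {d : nat} (P : probability T R).

Definition has_density (X : {RV P >-> d.-tuple R}) (f : d.-tuple R -> R) : Prop :=
  forall A : set (d.-tuple R), measurable A ->
    distribution P X A = (\int[@lebesgue_vec R d]_(t in A) (f t)%:E)%E.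

(* Each index has mass 1/n, so repeated points count with multiplicity. *)
Definition uniform_on (n : nat) (mu : 'I_n -> d.-tuple R)
    (C : {RV P >-> d.-tuple R}) : Prop :=
  forall A : set (d.-tuple R), measurable A ->
    distribution P C A = ((n%:R^-1)%:E * \sum_(i < n) \d_(mu i) A)%E.

End laws.

(* Main.v *)
Require Import Defs.
From HB Require Import structures.
From mathcomp Require Import all_boot all_order all_algebra.
From mathcomp Require Import all_classical all_reals all_analysis.
From mathcomp Require Import measurable_realfun ring lra.

(** The estimator is an average of the [n * nMC] independent variables
    [- ln g (mu_i + Z_ij)], and its mean is the entropy of [g], because [g] is
    the average of the translates of the Gaussian density by the [mu_i].  So its
    mean squared error is its variance, which is
    [(n * nMC)^-1] times the average over [i] of the variance [V_i] of
    [z |-> ln g (mu_i + z)] under the centred Gaussian measure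
    ([mc_entropy_mse_le]).

    The average of the [V_i] is at most the dimension [d].  By the Gaussian
    Poincare inequality ([gaussian_poincare]) [V_i] is at most
    [sigma ^ 2] times the mean of [|grad ln g (mu_i + z)|^2], and the average of
    these means over [i] is the integral of [g |grad ln g|^2], that is, the
    Fisher information of [g].  As [grad ln g (t)] is a weighted mean, with the
    posterior weights of the centres given [t], of the vectors
    [- (t - mu_i) / sigma ^ 2], the Cauchy-Schwarz inequality bounds this
    information by [d / sigma ^ 2] ([fisher_information_le]).  The mean squared
    error is therefore at most [d / (n * nMC)], which lies below both bounds of
    the theorem: their other terms are nonnegative.

    The Poincare inequality is stated for the symmetric form
    [E (f X - f Y)^2], twice the variance when [f] is square integrable.  All
    integrands are then nonnegative, so every exchange of integrals is an
    instance of Tonelli's theorem and no growth condition on [f] has to be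
    carried along; square integrability of [ln g] comes out at the end, from
    finiteness of the bound ([Lfun2_dispersion]).  On the line
    ([gaussian_poincare_line]), Cauchy-Schwarz gives
    [(f x - f y)^2 <= |x - y| * int_y^x f'^2], and integrating over [x] and [y]
    leaves [f' t ^ 2] against the kernel [2 E ((X - Y); Y < t < X)], which equals
    [2 sigma ^ 2] times the Gaussian density at [t].  The passage to [R^d] is the
    subadditivity of the variance over independent coordinates
    ([efron_stein]). *)

Set Implicit Arguments.
Unset Strict Implicit.
Unset Printing Implicit Defensive.

Import Order.TTheory GRing.Theory Num.Theory.
Import numFieldNormedType.Exports.

Local Open Scope classical_set_scope.
Local Open Scope ring_scope.

(** * Integration against a density *)

Section density.
Local Open Scope ereal_scope.
Context d (T : measurableType d) (R : realType).
Variables (mu nu : {measure set T -> \bar R}) (g : T -> R).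
Hypotheses (mg : measurable_fun setT g) (g0 : forall x, (0 <= g x)%R).
Hypothesis nuE : forall A, measurable A -> nu A = \int[mu]_(x in A) (g x)%:E.

Import HBNNSimple.

Lemma ge0_integral_density (F : T -> \bar R) :
  measurable_fun setT F -> (forall x, 0 <= F x) ->
  \int[nu]_x F x = \int[mu]_x (F x * (g x)%:E).
Proof.
move=> mF F0; pose f_ := nnsfun_approx measurableT mF.
have Fcvg x : EFin \o f_ ^~ x @ \oo --> F x by apply: cvg_nnsfun_approx.
transitivity (limn (fun n => \int[nu]_x (f_ n x)%:E)).
  rewrite -monotone_convergence//.
  - by apply: eq_integral => y _; apply/esym/cvg_lim => //; exact: Fcvg.
  - by move=> n; exact/measurable_EFinP.
  - by move=> n y _; rewrite lee_fin.
  - by move=> y _ m n mn; rewrite lee_fin; exact/lefP/nd_nnsfun_approx.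
rewrite [X in limn X](_ : _ = (fun n => \int[mu]_x ((f_ n x)%:E * (g x)%:E))).
  rewrite -monotone_convergence//.
  - apply: eq_integral => y _; apply/cvg_lim => //.
    by apply: cvgeZr => //; exact: Fcvg.
  - move=> n; apply: emeasurable_funM; exact/measurable_EFinP.
  - by move=> n y _; rewrite mule_ge0// lee_fin.
  - move=> y _ m n mn; apply: lee_wpmul2r; rewrite lee_fin//.
    exact/lefP/nd_nnsfun_approx.
apply/funext => n.
under eq_integral do rewrite fimfunE -fsumEFin//.
rewrite ge0_integral_fsum//; last 2 first.
- by move=> r; exact/measurable_EFinP/measurable_funM.
- by move=> r x _; rewrite EFinM nnfun_muleindic_ge0.
transitivity (\int[mu]_x
   (\sum_(r \in range (f_ n)) ((r * \1_(f_ n @^-1` [set r]) x)%:E * (g x)%:E))).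
  rewrite ge0_integral_fsum//; last 2 first.
  - move=> r; apply: emeasurable_funM; apply/measurable_EFinP => //.
    exact: measurable_funM.
  - move=> r x _; apply: mule_ge0; rewrite ?EFinM ?nnfun_muleindic_ge0 ?lee_fin//.
  apply: eq_fsbigr => r _.
  rewrite integralZl_indic_nnsfun// integral_indic// setIT nuE//.
  have [r0|r0] := ltP r 0%R.
    rewrite preimage_nnfun0// integral_set0 mule0 integral0_eq// => x _.
    by rewrite indic0 mulr0 mul0e.
  rewrite integral_mkcond -ge0_integralZl//; last 2 first.
  - apply/(measurable_restrictT _ _).1 => //; apply: measurable_funTS.
    exact/measurable_EFinP.
  - by move=> x _; rewrite patchE; case: ifP => //; rewrite lee_fin.
  apply: eq_integral => x _; rewrite patchE indicE.
  by case: ifP => _; rewrite ?mulr1 ?mulr0 ?mule0 ?mul0e.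
apply: eq_integral => x _; rewrite [in RHS]fimfunE -fsumEFin// ge0_mule_fsuml//.
by move=> r; rewrite EFinM nnfun_muleindic_ge0.
Qed.

End density.

(** * The centred Gaussian measure on R^d *)

Lemma measurable_tuple_cons (R : realType) d : measurable_fun setT (@tuple_cons R d).
Proof.
exact: (@measurable_cons _ _ (measurableTypeR R * d.-tuple R)%type R fst d snd).
Qed.

Lemma measurable_comp_cons (R : realType) d d' (U : measurableType d')
    (F : d.+1.-tuple R -> U) :
  measurable_fun setT F ->
  measurable_fun setT (fun p : measurableTypeR R * d.-tuple R => F (tuple_cons p)).
Proof. by move=> mF; exact: (measurableT_comp mF (@measurable_tuple_cons R d)). Qed.

Section lebesgue_vec_cons.
Local Open Scope ereal_scope.
Context {R : realType} {d : nat}.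

Lemma ge0_integral_lebesgue_vec_cons (F : d.+1.-tuple R -> \bar R) :
  measurable_fun setT F -> (forall t, 0 <= F t) ->
  \int[@lebesgue_vec R d.+1]_t F t =
  \int[lebesgue_measure]_x \int[@lebesgue_vec R d]_t F (tuple_cons (x, t)).
Proof.
move=> mF F0.
rewrite [LHS](ge0_integral_pushforward (@measurable_tuple_cons R d)
  (product_measure1 lebesgue_measure (@lebesgue_vec R d)))//.
rewrite preimage_setT fubini_tonelli1//.
  exact: measurable_comp_cons.
by move=> p; exact: F0.
Qed.

End lebesgue_vec_cons.

Section gauss.
Context {R : realType}.
Implicit Types (sigma : R).

Lemma norm2_sqr d (t : d.-tuple R) : norm2 t ^+ 2 = \sum_(k < d) tnth t k ^+ 2.
Proof. by rewrite /norm2 sqr_sqrtr// sumr_ge0// => i _; exact: sqr_ge0. Qed.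

Lemma gauss_pdfE d sigma (t : d.-tuple R) : gauss_pdf sigma t =
  (2 * pi * sigma ^+ 2) `^ (- (d%:R / 2)) *
  expR (- ((\sum_(k < d) tnth t k ^+ 2) / (2 * sigma ^+ 2))).
Proof. by rewrite /gauss_pdf norm2_sqr. Qed.

Lemma gauss_pdf_ge0 d sigma (t : d.-tuple R) : 0 <= gauss_pdf sigma t.
Proof. by rewrite mulr_ge0 ?powR_ge0 ?expR_ge0. Qed.

Lemma gauss_pdf_gt0 d sigma (t : d.-tuple R) : 0 < sigma -> 0 < gauss_pdf sigma t.
Proof.
move=> s0; rewrite mulr_gt0 ?expR_gt0 ?powR_gt0//.
by rewrite !mulr_gt0 ?pi_gt0 ?exprn_gt0.
Qed.

Lemma measurable_gauss_pdf d sigma : measurable_fun setT (@gauss_pdf R d sigma).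
Proof.
rewrite (_ : @gauss_pdf R d sigma = fun t => (2 * pi * sigma ^+ 2) `^ (- (d%:R / 2)) *
  expR (- ((\sum_(k < d) tnth t k ^+ 2) / (2 * sigma ^+ 2)))); last first.
  by apply/funext => t; rewrite gauss_pdfE.
apply: measurable_funM => //; apply: measurableT_comp => //.
apply: measurableT_comp => //; apply: measurable_funM => //.
by apply: measurable_sum => k; apply: measurable_funX; exact: measurable_tnth.
Qed.

Lemma gauss_pdf_cons d sigma (x : R) (t : d.-tuple R) : 0 < sigma ->
  gauss_pdf sigma (tuple_cons (x, t)) = normal_pdf 0 sigma x * gauss_pdf sigma t.
Proof.
move=> s0; have s20 : 0 < 2 * pi * sigma ^+ 2.
  by rewrite !mulr_gt0 ?pi_gt0 ?exprn_gt0.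
rewrite !gauss_pdfE normal_pdfE ?gt_eqF// big_ord_recl [tnth _ ord0]/=.
under eq_bigr do rewrite /tuple_cons tnthS.
rewrite (_ : - (d.+1%:R / 2) = - 2^-1 + - (d%:R / 2)); last first.
  by rewrite -natr1; ring.
rewrite powRD ?(gt_eqF s20) ?implybT//.
rewrite -[tnth _ ord0]/x; set S := \sum_(_ < d) _.
rewrite (_ : - ((x ^+ 2 + S) / (2 * sigma ^+ 2)) =
  - (x ^+ 2 / (2 * sigma ^+ 2)) + - (S / (2 * sigma ^+ 2))); last by ring.
rewrite expRD mulrACA.
congr (_ * _ * _).
  rewrite /normal_peak powRN powR12_sqrt ?(ltW s20)//.
  by congr (Num.sqrt _)^-1; ring.
by rewrite /normal_fun subr0 mulNr (mulr_natl _ 2).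
Qed.

End gauss.

Section gauss_prob.
Context {R : realType}.
Local Open Scope ereal_scope.

(** The positivity proof is a parameter so that the probability structure, which
    fails for [sigma = 0], can be attached to the measure itself. *)
Definition gauss_prob (sigma : R) (sigma_gt0 : (0 < sigma)%R) (d : nat)
    : set (d.-tuple R) -> \bar R :=
  fun A => \int[@lebesgue_vec R d]_(t in A) (gauss_pdf sigma t)%:E.

Variables (sigma : R) (sigma_gt0 : (0 < sigma)%R) (d : nat).

Let gp := @gauss_prob sigma sigma_gt0 d.

Let gp0 : gp set0 = 0. Proof. exact: integral_set0. Qed.

Let gp_ge0 A : 0 <= gp A.
Proof. by apply: integral_ge0 => t _; rewrite lee_fin gauss_pdf_ge0. Qed.

Let gp_sigma_additive : semi_sigma_additive gp.
Proof.
apply: semi_sigma_additive_nng_induced => [|t].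
  by apply/measurable_EFinP; exact: measurable_gauss_pdf.
by rewrite lee_fin gauss_pdf_ge0.
Qed.

HB.instance Definition _ := isMeasure.Build _ _ _ (gauss_prob sigma_gt0 (d := d))
  gp0 gp_ge0 gp_sigma_additive.

Lemma ge0_integral_gauss_prob (F : d.-tuple R -> \bar R) :
  measurable_fun setT F -> (forall t, 0 <= F t) ->
  \int[gauss_prob sigma_gt0 (d := d)]_t F t =
  \int[@lebesgue_vec R d]_t (F t * (gauss_pdf sigma t)%:E).
Proof.
move=> mF F0; apply: ge0_integral_density => //.
  exact: measurable_gauss_pdf.
exact: gauss_pdf_ge0.
Qed.

Lemma ge0_integral_normal_prob (m : R) (F : R -> \bar R) :
  measurable_fun setT F -> (forall x, 0 <= F x) ->
  \int[normal_prob m sigma]_x F x =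
  \int[lebesgue_measure]_x (F x * (normal_pdf m sigma x)%:E).
Proof.
move=> mF F0; apply: ge0_integral_density => //.
  exact: measurable_normal_pdf.
exact: normal_pdf_ge0.
Qed.

End gauss_prob.

Section gauss_prob_cons.
Context {R : realType}.
Local Open Scope ereal_scope.
Variables (sigma : R) (sigma_gt0 : (0 < sigma)%R).
Notation gauss := (gauss_prob sigma_gt0).

(** Splitting off one coordinate is what makes induction on the dimension
    possible: the first coordinate is a one-dimensional normal variable,
    independent of the others. *)
Lemma ge0_integral_gauss_cons d (F : d.+1.-tuple R -> \bar R) :
  measurable_fun setT F -> (forall t, 0 <= F t) ->
  \int[gauss (d := d.+1)]_t F t =
  \int[normal_prob 0 sigma]_x \int[gauss (d := d)]_t F (tuple_cons (x, t)).
Proof.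
move=> mF F0.
have mFc := measurable_comp_cons mF.
have mFx x : measurable_fun setT (fun t : d.-tuple R => F (tuple_cons (x, t))).
  exact: (measurableT_comp mFc (measurable_pair1 _)).
have mg d' : measurable_fun setT (fun t : d'.-tuple R => (gauss_pdf sigma t)%:E).
  by apply/measurable_EFinP; exact: measurable_gauss_pdf.
rewrite ge0_integral_gauss_prob// ge0_integral_lebesgue_vec_cons//; last 2 first.
- exact: emeasurable_funM mF (mg _).
- by move=> t; rewrite mule_ge0// lee_fin gauss_pdf_ge0.
have inner x : \int[gauss (d := d)]_t F (tuple_cons (x, t)) =
    \int[@lebesgue_vec R d]_t (F (tuple_cons (x, t)) * (gauss_pdf sigma t)%:E).
  by rewrite ge0_integral_gauss_prob.
rewrite ge0_integral_normal_prob//; last 2 first.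
- rewrite (funext inner).
  apply: (measurable_fun_fubini_tonelli_F (fun p : measurableTypeR R * d.-tuple R =>
     F (tuple_cons p) * (gauss_pdf sigma p.2)%:E)).
    by apply: emeasurable_funM => //; exact: measurableT_comp (mg d) measurable_snd.
  by move=> p; rewrite mule_ge0// lee_fin gauss_pdf_ge0.
- by move=> x; exact: integral_ge0.
apply: eq_integral => x _; rewrite inner -ge0_integralZr//; last 3 first.
- exact: emeasurable_funM (mFx x) (mg _).
- by move=> t _; rewrite mule_ge0// lee_fin gauss_pdf_ge0.
- by rewrite lee_fin normal_pdf_ge0.
apply: eq_integral => t _.
by rewrite gauss_pdf_cons// EFinM -[RHS]muleA; congr (_ * _); exact: muleC.
Qed.

Lemma gauss_probT d : gauss (d := d) setT = 1.
Proof.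
elim: d => [|d ih].
  rewrite /gauss_prob integral_dirac//.
    rewrite gauss_pdfE mul0r oppr0 powRr0 big_ord0 mul0r oppr0 expR0 mulr1.
    by rewrite mule1 diracT.
  by apply/measurable_EFinP; exact: measurable_gauss_pdf.
transitivity (\int[gauss (d := d.+1)]_t (cst 1 t)).
  by rewrite integral_cst// mul1e.
rewrite ge0_integral_gauss_cons//.
rewrite (eq_integral (cst 1)); last first.
  by move=> x _ /=; rewrite integral_cst// mul1e; exact: ih.
by rewrite integral_cst// mul1e; exact: probability_setT.
Qed.

HB.instance Definition _ d := @Measure_isProbability.Build _ _ R
  (gauss_prob sigma_gt0 (d := d)) (@gauss_probT d).

End gauss_prob_cons.

(** * The centred normal law on the line *)

Section normal_line.
Context {R : realType}.
Variables (s : R) (s0 : 0 < s).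
Notation N := (@normal_prob R 0 s).
Notation phi := (@normal_pdf R 0 s).
Notation leb := (@lebesgue_measure R).

Lemma normal_pdf0E x : phi x = normal_peak s * expR (- (x ^+ 2 / (2 * s ^+ 2))).
Proof.
by rewrite normal_pdfE ?gt_eqF// /normal_fun subr0 mulNr (mulr_natl _ 2).
Qed.

Lemma normal_pdf0N x : phi (- x) = phi x.
Proof. by rewrite !normal_pdf0E sqrrN. Qed.

Lemma is_derive_normal_pdf0 (x : R) :
  is_derive x 1 (phi : R^o -> R^o) (- (x / s ^+ 2) * phi x).
Proof.
rewrite normal_pdf0E; have -> : (phi : R^o -> R^o) =
    normal_peak s *: (fun y : R^o => expR ((- (2 * s ^+ 2)^-1) * (y ^+ 2))).
  apply/funext => y; rewrite normal_pdf0E /GRing.scale/=.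
  by congr (_ * expR _); rewrite mulNr mulrC.
apply: is_derive_eq.
rewrite [in LHS](_ : - (2 * s ^+ 2)^-1 * x ^+ 2 = - (x ^+ 2 / (2 * s ^+ 2)));
  last by ring.
set e := expR _; have := lt0r_neq0 s0 => ?.
by rewrite /GRing.scale/=; field.
Qed.

Lemma cvg_normal_pdf0_y : phi x @[x --> +oo] --> (0 : R).
Proof.
have c0 : 0 < (Num.sqrt (2 * s ^+ 2))^-1.
  by rewrite invr_gt0 sqrtr_gt0 mulr_gt0// exprn_gt0.
have -> : phi = fun x => normal_peak s * gauss_fun (x * (Num.sqrt (2 * s ^+ 2))^-1).
  apply/funext => x; rewrite normal_pdf0E /gauss_fun exprMn exprVn sqr_sqrtr//.
  by rewrite mulr_ge0// sqr_ge0.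
rewrite -(mulr0 (normal_peak s)); apply: cvgM; first exact: cvg_cst.
apply: (cvg_comp (fun x => x * _) gauss_fun); last exact: cvg_gauss_fun.
by apply/gt0_cvgMly => //; exact: cvg_id.
Qed.

Definition normal_cdf (t : R) : R := (\int[leb]_(x in `]-oo, t]) phi x)%R.

Lemma normal_cdfE t : (N `]-oo, t] = (normal_cdf t)%:E)%E.
Proof.
by rewrite /normal_cdf /Rintegral fineK//; exact: (@fin_num_measure _ _ _ N).
Qed.

Lemma is_derive_normal_cdf (x : R) :
  is_derive x 1 (normal_cdf : R^o -> R^o) (phi x).
Proof.
have [] := @continuous_FTC1 R phi -oo%O x (x + 1).
- by rewrite ltrDl.
- apply: integrableS (integrable_normal_pdf 0 s) => //.
- exact: ltNyr.
- by apply: continuous_normal_pdf; rewrite gt_eqF.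
move=> dc <-; rewrite derive1E; exact: derivableP.
Qed.

Let idTR : measurableTypeR R -> R := idfun.

#[local] HB.instance Definition _ :=
  @isMeasurableFun.Build _ _ _ _ idTR (@measurable_id _ _ setT).

Lemma cvg_normal_cdf_y : normal_cdf x @[x --> +oo] --> (1 : R).
Proof.
have := @cvg_cdfy1 _ _ _ N idTR.
rewrite (_ : cdf _ = EFin \o normal_cdf); last first.
  by apply/funext => t /=; rewrite -normal_cdfE.
by move/fine_cvg.
Qed.

(** As the density satisfies [phi' = - x / s^2 * phi], the function
    [- s^2 * phi - t * cdf] is a primitive of [(y - t) * phi y], and the latter is
    nonnegative on the domain of integration. *)
Lemma integral_normal_excess (t : R) :
  (\int[N]_y (Num.max (y - t) 0)%:E = (s ^+ 2 * phi t - t * (1 - normal_cdf t))%:E)%E.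
Proof.
rewrite ge0_integral_normal_prob//; last 2 first.
- by apply/measurable_EFinP; apply: measurable_maxr => //; exact: measurable_funB.
- by move=> y; rewrite lee_fin le_max lexx orbT.
pose F (y : R) := - (s ^+ 2 * phi y) - t * normal_cdf y.
transitivity (\int[leb]_(y in `[t, +oo[) ((y - t) * phi y)%:E)%E.
  rewrite [RHS]integral_mkcond; apply: eq_integral => y _.
  rewrite patchE mem_setE in_itv/= andbT -EFinM.
  have [ty|yt] := leP t y; first by rewrite max_l// subr_ge0.
  by rewrite max_r ?mul0r// subr_le0 ltW.
have dF (x : R) : is_derive x 1 (F : R^o -> R^o) ((x - t) * phi x).
  have d1 := is_derive_normal_pdf0 x; have d2 := is_derive_normal_cdf x.
  rewrite (_ : (F : R^o -> R^o) = (- s ^+ 2) *: (phi : R^o -> R^o) +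
    (- t) *: (normal_cdf : R^o -> R^o)); last first.
    by apply/funext => y; rewrite /F !fctE /GRing.scale/= !mulNr.
  apply: (is_derive_eq (is_deriveD (is_deriveZ (- s ^+ 2) d1) (is_deriveZ (- t) d2))).
  rewrite /GRing.scale/=; have := lt0r_neq0 s0.
  by move: (phi x) => p s_neq0; field.
rewrite (@ge0_continuous_FTC2y R _ F t (- t)).
- rewrite -EFinB /F; congr EFin; ring.
- by move=> x tx; rewrite mulr_ge0 ?subr_ge0// normal_pdf_ge0.
- apply: continuous_subspaceT => x; apply: (@cvgM R^o).
    by apply: cvgB; [exact: cvg_id|exact: cvg_cst].
  by apply: continuous_normal_pdf; rewrite gt_eqF.
- rewrite /F [X in _ --> X](_ : _ = - (s ^+ 2 * 0) - t * 1); last by ring.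
  apply: cvgB; [apply: cvgN; apply: cvgM|apply: cvgM]; try exact: cvg_cst.
    exact: cvg_normal_pdf0_y.
  exact: cvg_normal_cdf_y.
- by move=> x _; have [] := dF x.
- apply: cvg_at_right_filter; apply: differentiable_continuous.
  by apply/derivable1_diffP; have [] := dF t.
- by move=> x _; rewrite derive1E; have [_ ->] := dF x.
Qed.


End normal_line.

(** * The Poincare inequality on the line *)

Section poincare_line.
Context {R : realType}.
Variables (s : R) (s0 : 0 < s).
Notation N := (@normal_prob R 0 s).
Notation phi := (@normal_pdf R 0 s).
Notation leb := (@lebesgue_measure R).
Notation normal_cdf := (normal_cdf s).

Lemma ge0_integral_normal_probN (F : R -> \bar R) :
  measurable_fun setT F -> (forall x, (0 <= F x)%E) ->
  (\int[N]_x F (- x)%R = \int[N]_x F x)%E.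
Proof.
move=> mF F0.
have mphi := (measurable_EFinP _ _).2 (@measurable_normal_pdf R 0 s).
have mN : measurable_fun setT (-%R : measurableTypeR R -> measurableTypeR R) by [].
rewrite ge0_integral_normal_prob//; last exact: measurableT_comp.
rewrite ge0_integral_normal_prob//.
pose G x := (F x * (phi x)%:E)%E.
have mG : measurable_fun setT G by exact: emeasurable_funM.
have G0 x : (0 <= G x)%E by rewrite mule_ge0// lee_fin normal_pdf_ge0.
transitivity (\int[leb]_x G (- x)%R)%E.
  by apply: eq_integral => x _; rewrite /G normal_pdf0N.
pose nu := measure_function_pushforward__canonical__measure_function_Measure leb mN.
have <- : (\int[nu]_x G x = \int[leb]_x G x)%E.
  by apply: eq_measure_integral => A mA _; exact: lebesgue_measureN.
rewrite [RHS](@ge0_integral_pushforward _ _ _ _ R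
  (-%R : measurableTypeR R -> measurableTypeR R) mN leb setT G) ?preimage_setT//.
Qed.

Let pos (r : R) : R := Num.max r 0.
Let ind (r : R) : R := \1_`[0, +oo[%classic r.

Let indE (r : R) : ind r = ((0 <= r)%R)%:R.
Proof. by rewrite /ind indicE mem_setE in_itv/= andbT. Qed.

Let pos_ge0 (r : R) : 0 <= pos r. Proof. by rewrite le_max lexx orbT. Qed.
Let ind_ge0 (r : R) : 0 <= ind r. Proof. by rewrite indE. Qed.
Let mpos : measurable_fun setT pos. Proof. exact: measurable_maxr. Qed.
Let mind : measurable_fun setT ind. Proof. exact: measurable_indic. Qed.

Let integral_indB (t : R) : (\int[N]_x (ind (t - x))%:E = (normal_cdf t)%:E)%E.
Proof.
rewrite -normal_cdfE.
transitivity (\int[N]_x (\1_`]-oo, t]%classic x)%:E)%E.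
  by apply: eq_integral => x _; rewrite indE subr_ge0 indicE mem_setE in_itv.
by rewrite integral_indic// setIT.
Qed.

Lemma normal_cdfN (t : R) : normal_cdf (- t) = 1 - normal_cdf t.
Proof.
have e1 : N `[t, +oo[ = (normal_cdf (- t))%:E.
  rewrite -integral_indB -ge0_integral_normal_probN//=; last 2 first.
  - apply/measurable_EFinP; apply: measurableT_comp => //; exact: measurable_funB.
  - by move=> x; rewrite lee_fin.
  transitivity (\int[N]_x (\1_`[t, +oo[%classic x)%:E)%E.
    by rewrite integral_indic// setIT.
  apply: eq_integral => x _.
  by rewrite indE opprK addrC subr_ge0 indicE mem_setE in_itv/= andbT.
have e2 : N `[t, +oo[ = N `]t, +oo[.
  rewrite /normal_prob -integral_itv_obnd_cbnd//.
  by apply: measurable_funTS; apply/measurable_EFinP; exact: measurable_normal_pdf.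
have e3 : N `]t, +oo[ = (1 - N `]-oo, t])%E.
  by rewrite -(@probability_setC _ _ _ N)// setCitvl.
by apply: EFin_inj; rewrite -e1 e2 e3 normal_cdfE.
Qed.

Let integral_indBr (t : R) :
  (\int[N]_x (ind (x - t))%:E = (1 - normal_cdf t)%:E)%E.
Proof.
rewrite -normal_cdfN -integral_indB -[LHS]ge0_integral_normal_probN//=; last 2 first.
- apply/measurable_EFinP; apply: measurableT_comp => //; exact: measurable_funB.
- by move=> x; rewrite lee_fin.
by apply: eq_integral => x _; rewrite addrC.
Qed.

Let integral_posB (t : R) :
  (\int[N]_x (pos (t - x))%:E = (s ^+ 2 * phi t + t * normal_cdf t)%:E)%E.
Proof.
rewrite -[LHS]ge0_integral_normal_probN//=; last 2 first.
- apply/measurable_EFinP; apply: measurableT_comp => //; exact: measurable_funB.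
- by move=> x; rewrite lee_fin.
have := integral_normal_excess s0 (- t).
rewrite normal_cdfN normal_pdf0N//.
rewrite (_ : _ - _ = s ^+ 2 * phi t + t * normal_cdf t) => [<-|].
  by apply: eq_integral => x _; rewrite /pos !opprK [in LHS]addrC.
by ring.
Qed.

(** For [x <= t <= y] this is [(y - t) + (t - x) = y - x].  Each summand is a
    function of [x] times a function of [y], so the double integral factors. *)
Let kern (x y t : R) := pos (y - t) * ind (t - x) + pos (t - x) * ind (y - t).

Let kern_ge0 x y t : 0 <= kern x y t.
Proof. by rewrite addr_ge0// mulr_ge0. Qed.

Let kern_eq x y t : x <= t <= y -> kern x y t = y - x.
Proof.
move=> /andP[xt ty]; rewrite /kern !indE !subr_ge0 xt ty !mulr1 /pos.
by rewrite !max_l ?subr_ge0//; ring.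
Qed.

(** With [c = cdf t], the two products integrate to
    [(s^2 phi - t (1 - c)) c] and [(s^2 phi + t c) (1 - c)]; the terms in [t]
    cancel. *)
Let integral_kern (t : R) :
  (\int[N]_x \int[N]_y (kern x y t)%:E = (s ^+ 2 * phi t)%:E)%E.
Proof.
have m1 (h : R -> R) : measurable_fun setT h ->
    measurable_fun setT (fun x : R => (h (x - t))%:E).
  move=> mh; apply/measurable_EFinP; apply: measurableT_comp => //.
  exact: measurable_funB.
have m2 (h : R -> R) : measurable_fun setT h ->
    measurable_fun setT (fun x : R => (h (t - x))%:E).
  move=> mh; apply/measurable_EFinP; apply: measurableT_comp => //.
  exact: measurable_funB.
have inner x : (\int[N]_y (kern x y t)%:E =
    (s ^+ 2 * phi t - t * (1 - normal_cdf t))%:E * (ind (t - x))%:E +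
    (1 - normal_cdf t)%:E * (pos (t - x))%:E)%E.
  under eq_integral do rewrite EFinD 2!EFinM.
  rewrite ge0_integralD//; last 4 first.
  - by move=> y _; rewrite -EFinM lee_fin mulr_ge0.
  - by apply: emeasurable_funM => //; exact: m1.
  - by move=> y _; rewrite -EFinM lee_fin mulr_ge0.
  - by apply: emeasurable_funM => //; exact: m1.
  rewrite ge0_integralZr//; last 3 first.
  - exact: m1.
  - by move=> y _; rewrite lee_fin.
  - by rewrite lee_fin.
  rewrite ge0_integralZl//; last 3 first.
  - exact: m1.
  - by move=> y _; rewrite lee_fin.
  - by rewrite lee_fin.
  by rewrite (integral_normal_excess s0) integral_indBr [X in (_ + X)%E]muleC.
under eq_integral do rewrite inner.
have c0 : 0 <= 1 - normal_cdf t.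
  by rewrite -lee_fin -integral_indBr integral_ge0// => x _; rewrite lee_fin.
have a0 : 0 <= s ^+ 2 * phi t - t * (1 - normal_cdf t).
  rewrite -lee_fin -(integral_normal_excess s0) integral_ge0// => x _.
  by rewrite lee_fin pos_ge0.
rewrite ge0_integralD//; last 4 first.
- by move=> y _; rewrite -EFinM lee_fin mulr_ge0.
- by apply: emeasurable_funM => //; exact: m2.
- by move=> y _; rewrite -EFinM lee_fin mulr_ge0.
- by apply: emeasurable_funM => //; exact: m2.
rewrite !ge0_integralZl_EFin//; last 4 first.
- by move=> y _; rewrite lee_fin.
- exact: m2.
- by move=> y _; rewrite lee_fin.
- exact: m2.
rewrite integral_indB integral_posB -!EFinM -EFinD; congr EFin; ring.
Qed.

Lemma sqr_increment_le (f f' : R -> R) (x y : R) : x < y ->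
  (forall u : R, is_derive u 1 (f : R^o -> R^o) (f' u)) -> continuous f' ->
  (((f y - f x) ^+ 2)%:E <=
    \int[leb]_(t in `[x, y]) ((y - x) * f' t ^+ 2)%:E)%E.
Proof.
move=> xy df cf.
(* The slope of the chord turns Cauchy-Schwarz into the pointwise inequality *)
(* 2 c f' - c ^ 2 <= f' ^ 2, whose left-hand side has an explicit primitive. *)
pose c := (f y - f x) / (y - x).
pose G u := (y - x) * (2 * c * f' u - c ^+ 2).
pose F u := (y - x) * (2 * c * f u - c ^+ 2 * u).
have yx0 : y - x != 0 by rewrite subr_eq0 gt_eqF.
have cG : continuous G.
  move=> u; apply: cvgM; first exact: cvg_cst.
  apply: cvgB; last exact: cvg_cst.
  by apply: cvgM; [exact: cvg_cst|exact: cf].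
have dF (u : R) : is_derive u 1 (F : R^o -> R^o) (G u).
  have d1 := df u.
  rewrite (_ : (F : R^o -> R^o) = ((y - x) * (2 * c)) *: (f : R^o -> R^o) +
    (- ((y - x) * c ^+ 2)) *: (id : R^o -> R^o)); last first.
    by apply/funext => v; rewrite /F !fctE /GRing.scale/=; ring.
  apply: (is_derive_eq
    (is_deriveD (is_deriveZ _ d1) (is_deriveZ _ (is_derive_id _ _)))).
  by rewrite /GRing.scale/= /G; ring.
have cF : continuous F.
  move=> u; apply: differentiable_continuous.
  by apply/derivable1_diffP; have [] := dF u.
have <- : (\int[leb]_(t in `[x, y]) (G t)%:E = ((f y - f x) ^+ 2)%:E)%E.
  rewrite (@continuous_FTC2 _ G F)//.
  - by rewrite -EFinB; congr EFin; rewrite /F /c; field.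
  - exact: continuous_subspaceT.
  - split => [u _||]; first by have [] := dF u.
      by apply: cvg_at_right_filter; exact: cF.
    by apply: cvg_at_left_filter; exact: cF.
  - by move=> u _; rewrite derive1E; have [_ ->] := dF u.
apply: le_integral => //.
- apply: continuous_compact_integrable; first exact: segment_compact.
  exact: continuous_subspaceT.
- apply: continuous_compact_integrable; first exact: segment_compact.
  apply: continuous_subspaceT => u; apply: cvgM; first exact: cvg_cst.
  by rewrite /exprz; apply: cvgM; exact: cf.
- move=> t _; rewrite lee_fin ler_pM2l ?subr_gt0// -subr_ge0.
  by rewrite (_ : _ - _ = (f' t - c) ^+ 2) ?sqr_ge0//; ring.
Qed.

Let Phi (f' : R -> R) (x y t : R) := (kern x y t * f' t ^+ 2)%:E.

Let Phi_ge0 f' x y t : (0 <= Phi f' x y t)%E.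
Proof. by rewrite lee_fin mulr_ge0// sqr_ge0. Qed.

Let mT := measurableTypeR R.

Let measurable_kern :
  measurable_fun setT (fun p : mT * mT * mT => kern p.1.1 p.1.2 p.2).
Proof.
have m2 : measurable_fun setT (fun p : mT * mT * mT => p.2 : R).
  exact: measurable_snd.
have m11 : measurable_fun setT (fun p : mT * mT * mT => p.1.1 : R).
  exact: (measurableT_comp measurable_fst measurable_fst).
have m12 : measurable_fun setT (fun p : mT * mT * mT => p.1.2 : R).
  exact: (measurableT_comp measurable_snd measurable_fst).
by apply: measurable_funD; apply: measurable_funM;
  (apply: measurableT_comp; [done|exact: measurable_funB]).
Qed.

Let measurable_Phi f' : measurable_fun setT f' ->
  measurable_fun setT (fun p : mT * mT * mT => Phi f' p.1.1 p.1.2 p.2).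
Proof.
move=> mf; apply/measurable_EFinP; apply: measurable_funM; first exact: measurable_kern.
by apply: measurable_funX; exact: (measurableT_comp mf measurable_snd).
Qed.

Let increment_le_kern (f f' : R -> R) (x y : R) :
  (forall u : R, is_derive u 1 (f : R^o -> R^o) (f' u)) -> continuous f' ->
  (((f x - f y) ^+ 2)%:E <=
    \int[leb]_t Phi f' x y t + \int[leb]_t Phi f' y x t)%E.
Proof.
move=> df cf.
have mPhi u v : measurable_fun setT (Phi f' u v).
  apply: (measurableT_comp (measurable_Phi (continuous_measurable_fun cf))
     (measurable_pair1 (u, v) : measurable_fun setT (fun t : mT => ((u, v), t)))).
wlog xy : x y / x < y => [hw|].
  have [/hw//|/hw h|->] := ltgtP x y.
    by rewrite -sqrrN opprB addeC.
  by rewrite subrr expr0n/= adde_ge0// integral_ge0.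
rewrite -sqrrN opprB; apply: (le_trans (sqr_increment_le xy df cf)).
rewrite -[leLHS]adde0 leeD//; last exact: integral_ge0.
apply: (@le_trans _ _ (\int[leb]_(t in `[x, y]) Phi f' x y t)%E).
  rewrite le_eqVlt; apply/orP; left; apply/eqP; apply: eq_integral => t.
  by rewrite inE/= in_itv/= => xty; rewrite /Phi kern_eq.
apply: ge0_subset_integral => //; exact: mPhi.
Qed.

(** The order of [x] and [y] is unknown, so the increment is bounded by the
    kernel taken in both orders; by symmetry each contributes
    [s^2 * int f'^2], whence the factor 2. *)
Lemma gaussian_poincare_line (f f' : R -> R) :
  (forall u : R, is_derive u 1 (f : R^o -> R^o) (f' u)) -> continuous f' ->
  (\int[N]_x \int[N]_y ((f x - f y) ^+ 2)%:E <=
    (2 * s ^+ 2)%:E * \int[N]_x (f' x ^+ 2)%:E)%E.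
Proof.
move=> df cf; have mf' := continuous_measurable_fun cf.
have mf : measurable_fun setT f.
  apply: continuous_measurable_fun => u; apply: differentiable_continuous.
  by apply/derivable1_diffP; have [] := df u.
have mP := measurable_Phi mf'.
pose J (p : mT * mT) : \bar R := (\int[leb]_t Phi f' p.1 p.2 t)%E.
have mJ : measurable_fun setT J.
  exact: (measurable_fun_fubini_tonelli_F
    (fun p : (mT * mT) * mT => Phi f' p.1.1 p.1.2 p.2)).
have J0 p : (0 <= J p)%E by exact: integral_ge0.
have mswap : measurable_fun setT (fun p : mT * mT => (p.2, p.1)).
  exact: measurable_swap.
have mJs : measurable_fun setT (fun p : mT * mT => J (p.2, p.1)).
  exact: measurableT_comp mJ mswap.
have mD : measurable_fun setT (fun p : mT * mT => ((f p.1 - f p.2) ^+ 2)%:E).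
  apply/measurable_EFinP; apply: measurable_funX; apply: measurable_funB.
    exact: measurableT_comp mf measurable_fst.
  exact: measurableT_comp mf measurable_snd.
have mJx x : measurable_fun setT (fun y : mT => J (x, y)).
  exact: measurableT_comp mJ (measurable_pair1 _).
have mJy y : measurable_fun setT (fun x : mT => J (x, y)).
  exact: measurableT_comp mJ (measurable_pair2 _).
have I1 : (\int[N]_x \int[N]_y J (x, y) =
    (s ^+ 2)%:E * \int[N]_x (f' x ^+ 2)%:E)%E.
  transitivity (\int[N]_x \int[leb]_t \int[N]_y Phi f' x y t)%E.
    apply: eq_integral => x _.
    rewrite [LHS](fubini_tonelli (fun p : mT * mT => Phi f' x p.1 p.2))//.
    apply: (measurableT_comp mP (_ : measurable_fun setT
      (fun p : mT * mT => ((x, p.1), p.2)))).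
    by apply: measurable_fun_pair => //; exact: measurable_fun_pair.
  rewrite (fubini_tonelli (fun p : mT * mT => \int[N]_y Phi f' p.1 y p.2)%E);
    last 2 first.
  - apply: (measurable_fun_fubini_tonelli_F
      (fun p : (mT * mT) * mT => Phi f' p.1.1 p.2 p.1.2)) => //.
    apply: (measurableT_comp mP (_ : measurable_fun setT
      (fun p : mT * mT * mT => ((p.1.1, p.2), p.1.2)))).
    apply: measurable_fun_pair; last exact: measurableT_comp measurable_fst.
    by apply: measurable_fun_pair => //; exact: measurableT_comp measurable_fst.
  - by move=> p; exact: integral_ge0.
  rewrite ge0_integral_normal_prob//; last 2 first.
  - by apply/measurable_EFinP; exact: measurable_funX.
  - by move=> x; rewrite lee_fin sqr_ge0.
  rewrite -ge0_integralZl//; last 3 first.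
  - apply/measurable_EFinP; apply: measurable_funM; last exact: measurable_normal_pdf.
    exact: measurable_funX.
  - by move=> x _; rewrite -EFinM lee_fin mulr_ge0 ?sqr_ge0 ?normal_pdf_ge0.
  - by rewrite lee_fin sqr_ge0.
  apply: eq_integral => t _ /=.
  transitivity ((s ^+ 2 * phi t)%:E * (f' t ^+ 2)%:E)%E.
    rewrite -integral_kern.
    have mk : measurable_fun setT (fun p : mT * mT => (kern p.1 p.2 t)%:E).
      apply/measurable_EFinP.
      exact: (measurableT_comp measurable_kern (measurable_pair2 t)).
    rewrite -ge0_integralZr//; last 3 first.
    - apply: (measurable_fun_fubini_tonelli_F
        (fun p : mT * mT => (kern p.1 p.2 t)%:E)) => //.
      by move=> p; rewrite lee_fin.
    - by move=> x _; apply: integral_ge0 => y _; rewrite lee_fin.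
    - by rewrite lee_fin sqr_ge0.
    apply: eq_integral => x _; rewrite -ge0_integralZr//; last 3 first.
    - exact: (measurableT_comp mk (measurable_pair1 x)).
    - by move=> y _; rewrite lee_fin.
    - by rewrite lee_fin sqr_ge0.
  by rewrite -!EFinM; congr EFin; ring.
have I2 : (\int[N]_x \int[N]_y J (y, x) = \int[N]_x \int[N]_y J (x, y))%E.
  exact: (fubini_tonelli (fun p : mT * mT => J (p.2, p.1))).
have mF1 : measurable_fun setT (fun x => \int[N]_y J (x, y))%E.
  exact: measurable_fun_fubini_tonelli_F.
have mF2 : measurable_fun setT (fun x => \int[N]_y J (y, x))%E.
  exact: (measurable_fun_fubini_tonelli_F (fun p : mT * mT => J (p.2, p.1))).
have <- : (\int[N]_x \int[N]_y (J (x, y) + J (y, x)) =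
    (2 * s ^+ 2)%:E * \int[N]_x (f' x ^+ 2)%:E)%E.
  rewrite (eq_integral (fun x => \int[N]_y J (x, y) + \int[N]_y J (y, x)))%E;
    last first.
    by move=> x _; rewrite ge0_integralD.
  rewrite ge0_integralD; [|exact: measurableT|by move=> x _; exact: integral_ge0|
    exact: mF1|by move=> x _; exact: integral_ge0|exact: mF2].
  apply: (etrans (congr2 (fun a b => a + b)%E I1 (etrans I2 I1))).
  clear -s0.
  rewrite (_ : (2 * s ^+ 2)%:E = ((s ^+ 2)%:E + (s ^+ 2)%:E)%E).
    by rewrite ge0_muleDl// lee_fin sqr_ge0.
  by rewrite -EFinD; congr EFin; ring.
apply: ge0_le_integral.
- exact: measurableT.
- by move=> x _; apply: integral_ge0 => y _; rewrite lee_fin sqr_ge0.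
- apply: (measurable_fun_fubini_tonelli_F
    (fun p : mT * mT => ((f p.1 - f p.2) ^+ 2)%:E)).
    exact: mD.
  by move=> p; rewrite lee_fin sqr_ge0.
- apply: (measurable_fun_fubini_tonelli_F (fun p : mT * mT => J p + J (p.2, p.1)))%E.
    exact: emeasurable_funD mJ mJs.
  by move=> p; apply: adde_ge0; exact: J0.
move=> x _; apply: ge0_le_integral.
- exact: measurableT.
- by move=> y _; rewrite lee_fin sqr_ge0.
- exact: (measurableT_comp mD (measurable_pair1 x)).
- exact: emeasurable_funD (mJx x) (mJy x).
by move=> y _; exact: increment_le_kern.
Qed.

(** The Poincare inequality for the identity bounds [E (X - Y)^2] by [2 s^2].
    By symmetry of the law this is also [E (X + Y)^2], and the two
    add up to [4 E X^2]. *)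
Lemma normal_second_moment_le : (\int[N]_x (x ^+ 2)%:E <= (s ^+ 2)%:E)%E.
Proof.
set M := (\int[N]_x (x ^+ 2)%:E)%E.
have M0 : (0 <= M)%E by apply: integral_ge0 => x _; rewrite lee_fin sqr_ge0.
have msq (x : R) : measurable_fun setT (fun y : R => ((x - y) ^+ 2)%:E).
  by apply/measurable_EFinP; apply: measurable_funX; exact: measurable_funB.
have msq' (x : R) : measurable_fun setT (fun y : R => ((x + y) ^+ 2)%:E).
  by apply/measurable_EFinP; apply: measurable_funX; exact: measurable_funD.
have sym x : (\int[N]_y ((x - y) ^+ 2)%:E + \int[N]_y ((x - y) ^+ 2)%:E =
    (2 * x ^+ 2)%:E + 2%:E * M)%E.
  have E : (\int[N]_y ((x - y) ^+ 2)%:E = \int[N]_y ((x + y) ^+ 2)%:E)%E.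
    rewrite -(@ge0_integral_normal_probN (fun y => ((x - y) ^+ 2)%:E)%E)//.
      by apply: eq_integral => y _; rewrite opprK.
    by move=> y; rewrite lee_fin sqr_ge0.
  rewrite [X in (_ + X)%E]E.
  rewrite -ge0_integralD; [|exact: measurableT|by move=> y _; rewrite lee_fin sqr_ge0|
    exact: msq|by move=> y _; rewrite lee_fin sqr_ge0|exact: msq'].
  rewrite (eq_integral (fun y : mT =>
      (2 * x ^+ 2)%:E + 2%:E * ((y : R) ^+ 2)%:E)%E); last first.
    by move=> y _; rewrite -EFinM -!EFinD; congr EFin; ring.
  have m2 : measurable_fun setT (fun y : R => (y ^+ 2)%:E).
    by apply/measurable_EFinP; exact: measurable_funX.
  rewrite ge0_integralD; [|exact: measurableT|
    by move=> y _; rewrite lee_fin mulr_ge0// sqr_ge0|exact: measurable_cst|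
    by move=> y _; rewrite -EFinM lee_fin mulr_ge0// sqr_ge0|exact: emeasurable_funM].
  rewrite integral_cst// [X in (_ * X + _)%E](@probability_setT _ _ _ N) mule1.
  by rewrite ge0_integralZl_EFin// => y _; rewrite lee_fin sqr_ge0.
have mDD : measurable_fun setT (fun p : mT * mT => ((p.1 - p.2) ^+ 2)%:E).
  apply/measurable_EFinP; apply: measurable_funX; apply: measurable_funB.
    exact: measurable_fst.
  exact: measurable_snd.
have mI : measurable_fun setT (fun x : R => \int[N]_y ((x - y) ^+ 2)%:E)%E.
  apply: (measurable_fun_fubini_tonelli_F
    (fun p : mT * mT => ((p.1 - p.2) ^+ 2)%:E)) => //.
  by move=> p; rewrite lee_fin sqr_ge0.
have I0 x : (0 <= \int[N]_y ((x - y) ^+ 2)%:E)%E.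
  by apply: integral_ge0 => y _; rewrite lee_fin sqr_ge0.
have D2 : (\int[N]_x \int[N]_y ((x - y) ^+ 2)%:E <= (2 * s ^+ 2)%:E)%E.
  apply: (le_trans (@gaussian_poincare_line id (cst 1) (fun u => is_derive_id u 1)
    (fun u => cvg_cst _))).
  under [X in (_ * X)%E]eq_integral do rewrite /= expr1n.
  rewrite integral_cst// mul1e.
  by rewrite [X in (_ * X)%E](@probability_setT _ _ _ N) mule1.
have : (4%:E * M <= 4%:E * (s ^+ 2)%:E)%E; last by rewrite lee_pmul2l.
apply: (@le_trans _ _ ((2 * s ^+ 2)%:E + (2 * s ^+ 2)%:E)%E); last first.
  by rewrite -EFinM -EFinD lee_fin; lra.
apply: le_trans (leeD D2 D2); rewrite -ge0_integralD//.
under eq_integral do rewrite sym.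
rewrite ge0_integralD; [|exact: measurableT|
  by move=> y _; rewrite lee_fin mulr_ge0// sqr_ge0|
  by apply/measurable_EFinP; apply: measurable_funM => //; exact: measurable_funX|
  by move=> y _; rewrite mule_ge0|exact: measurable_cst].
under eq_integral do rewrite EFinM.
rewrite integral_cst// [X in (_ + _ * X)%E](@probability_setT _ _ _ N) mule1.
rewrite ge0_integralZl_EFin//; last 2 first.
- by move=> y _; rewrite lee_fin sqr_ge0.
- by apply/measurable_EFinP; exact: measurable_funX.
by rewrite -ge0_muleDl// -EFinD -natrD.
Qed.

End poincare_line.

(** * Subadditivity of the variance over independent coordinates *)

Section efron_stein.
Local Open Scope ereal_scope.
Context d1 d2 (T1 : measurableType d1) (T2 : measurableType d2) (R : realType).
Variables (m1 : probability T1 R) (m2 : probability T2 R).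
Variables (F : T1 * T2 -> R) (mF : measurable_fun setT F).

Let U : measurableType _ := ((T1 * T1) * (T2 * T2))%type.
Let M1 : probability (T1 * T1)%type R := m1 \x m1.
Let M2 : probability (T2 * T2)%type R := m2 \x m2.
Let I (Q : U -> \bar R) := \int[M1 \x M2]_p Q p.

Let I12 Q : measurable_fun setT Q -> (forall p, 0 <= Q p) ->
  I Q = \int[M1]_p \int[M2]_q Q (p, q).
Proof. by move=> mQ Q0; exact: fubini_tonelli1. Qed.

Let intM1 H : measurable_fun setT H -> (forall p, 0 <= H p) ->
  \int[M1]_p H p = \int[m1]_x \int[m1]_x' H (x, x').
Proof. by move=> mQ Q0; exact: fubini_tonelli1. Qed.

Let intM2 H : measurable_fun setT H -> (forall p, 0 <= H p) ->
  \int[M2]_p H p = \int[m2]_x \int[m2]_x' H (x, x').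
Proof. by move=> mQ Q0; exact: fubini_tonelli1. Qed.

Let mQ1 Q : measurable_fun setT Q -> (forall p, 0 <= Q p) ->
  measurable_fun setT (fun p : T1 * T1 => \int[M2]_q Q (p, q)).
Proof. by move=> mQ Q0; exact: measurable_fun_fubini_tonelli_F. Qed.

Let mQ2 (Q : U -> \bar R) p : measurable_fun setT Q ->
  measurable_fun setT (fun q : T2 * T2 => Q (p, q)).
Proof. by move=> mQ; exact: (measurableT_comp mQ (measurable_pair1 p)). Qed.

Let I_iter Q : measurable_fun setT Q -> (forall p, 0 <= Q p) ->
  I Q = \int[m1]_x \int[m1]_x' \int[m2]_t \int[m2]_t' Q ((x, x'), (t, t')).
Proof.
move=> mQ Q0; rewrite I12// intM1; last 2 first.
- exact: mQ1.
- by move=> p; exact: integral_ge0.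
apply: eq_integral => x _; apply: eq_integral => x' _.
by rewrite intM2//; exact: mQ2.
Qed.

Let q1 (Q : U -> \bar R) (p : U) := Q ((p.1.2, p.1.1), p.2).
Let q2 (Q : U -> \bar R) (p : U) := Q (p.1, (p.2.2, p.2.1)).

Let mq1 Q : measurable_fun setT Q -> measurable_fun setT (q1 Q).
Proof.
move=> mQ; apply: (measurableT_comp mQ); apply: measurable_fun_pair.
  exact: measurableT_comp (@measurable_swap _ _ T1 T1) measurable_fst.
exact: measurable_snd.
Qed.

Let mq2 Q : measurable_fun setT Q -> measurable_fun setT (q2 Q).
Proof.
move=> mQ; apply: (measurableT_comp mQ); apply: measurable_fun_pair.
  exact: measurable_fst.
exact: measurableT_comp (@measurable_swap _ _ T2 T2) measurable_snd.
Qed.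

Let I_q1 Q : measurable_fun setT Q -> (forall p, 0 <= Q p) -> I (q1 Q) = I Q.
Proof.
move=> mQ Q0; have Q0' p : 0 <= q1 Q p by exact: Q0.
rewrite (I_iter (mq1 mQ) Q0') (I_iter mQ Q0).
rewrite [LHS](fubini_tonelli (fun p : T1 * T1 =>
  \int[m2]_t \int[m2]_t' Q ((p.2, p.1), (t, t'))))//.
  apply: (eq_measurable_fun (fun p : T1 * T1 => \int[M2]_q q1 Q (p, q))).
    by move=> p _; rewrite intM2//; apply: mQ2; exact: mq1.
  by apply: mQ1 => //; exact: mq1.
by move=> p; apply: integral_ge0 => t _; exact: integral_ge0.
Qed.

Let I_q2 Q : measurable_fun setT Q -> (forall p, 0 <= Q p) -> I (q2 Q) = I Q.
Proof.
move=> mQ Q0; have Q0' p : 0 <= q2 Q p by exact: Q0.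
rewrite (I_iter (mq2 mQ) Q0') (I_iter mQ Q0).
apply: eq_integral => x _; apply: eq_integral => x' _.
rewrite [LHS](fubini_tonelli (fun q : T2 * T2 => Q ((x, x'), (q.2, q.1))))//.
exact: (measurableT_comp (mQ2 (x, x') mQ) (@measurable_swap _ _ T2 T2)).
Qed.

Let int_cst1 d0 (T0 : measurableType d0) (m : probability T0 R) (k : \bar R) :
  \int[m]_x k = k.
Proof.
by rewrite integral_cst//= [X in _ * X](@probability_setT _ _ _ m) mule1.
Qed.

Let V (p q : T1 * T2) : \bar R := ((F p - F q) ^+ 2)%:E.

Let V0 p q : 0 <= V p q. Proof. by rewrite lee_fin sqr_ge0. Qed.

Let mV d0 (T0 : measurableType d0) (f g : T0 -> T1 * T2) :
  measurable_fun setT f -> measurable_fun setT g ->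
  measurable_fun setT (fun z => V (f z) (g z)).
Proof.
move=> mf mg; apply/measurable_EFinP; apply: measurable_funX.
by apply: measurable_funB;
  [exact: measurableT_comp mF mf|exact: measurableT_comp mF mg].
Qed.

(** Write [a, b, c, e] for the values of [F] at [(x, t)], [(x', t)], [(x, t')],
    [(x', t')].  The expansion of [(a - b - c + e)^2 >= 0] reads
    [(a - e)^2 + (b - c)^2 <= (a - b)^2 + (c - e)^2 + (a - c)^2 + (b - e)^2],
    and exchanging [x] with [x'], or [t] with [t'], shows that the terms have
    pairwise the same integral. *)
Lemma efron_stein :
  \int[m1]_x \int[m2]_t \int[m1]_x' \int[m2]_t' ((F (x, t) - F (x', t')) ^+ 2)%:E <=
  \int[m2]_t \int[m1]_x \int[m1]_x' ((F (x, t) - F (x', t)) ^+ 2)%:E +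
  \int[m1]_x \int[m2]_t \int[m2]_t' ((F (x, t) - F (x, t')) ^+ 2)%:E.
Proof.
pose a (p : U) := (p.1.1, p.2.1). pose b (p : U) := (p.1.2, p.2.1).
pose c (p : U) := (p.1.1, p.2.2). pose e (p : U) := (p.1.2, p.2.2).
have m11 : measurable_fun setT (fun p : U => p.1.1).
  by apply: measurableT_comp measurable_fst.
have m12 : measurable_fun setT (fun p : U => p.1.2).
  by apply: measurableT_comp measurable_fst.
have m21 : measurable_fun setT (fun p : U => p.2.1).
  by apply: measurableT_comp measurable_snd.
have m22 : measurable_fun setT (fun p : U => p.2.2).
  by apply: measurableT_comp measurable_snd.
have ma : measurable_fun setT a by exact: measurable_fun_pair.
have mb : measurable_fun setT b by exact: measurable_fun_pair.
have mc : measurable_fun setT c by exact: measurable_fun_pair.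
have me : measurable_fun setT e by exact: measurable_fun_pair.
pose Q (f g : U -> T1 * T2) p := V (f p) (g p).
have mQ f g : measurable_fun setT f -> measurable_fun setT g ->
    measurable_fun setT (Q f g).
  exact: mV.
have Q0 f g p : 0 <= Q f g p by exact: V0.
have Ebc : I (Q b c) = I (Q a e) by rewrite -(I_q1 (mQ _ _ ma me) (Q0 _ _)).
have Ece : I (Q c e) = I (Q a b) by rewrite -(I_q2 (mQ _ _ ma mb) (Q0 _ _)).
have Ebe : I (Q b e) = I (Q a c) by rewrite -(I_q1 (mQ _ _ ma mc) (Q0 _ _)).
have key : I (Q a e) + I (Q b c) <=
    (I (Q a b) + I (Q c e)) + (I (Q a c) + I (Q b e)).
  rewrite /I -!ge0_integralD//; [|solve [by auto|exact: mQ|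
    by apply: emeasurable_funD; exact: mQ|by move=> *; exact: adde_ge0]..].
  apply: ge0_le_integral => //.
  - by move=> *; exact: adde_ge0.
  - by apply: emeasurable_funD; exact: mQ.
  - by apply: emeasurable_funD; apply: emeasurable_funD; exact: mQ.
  move=> p _; rewrite /Q /V -!EFinD lee_fin -subr_ge0.
  rewrite (_ : _ - _ = (F (a p) - F (b p) - F (c p) + F (e p)) ^+ 2)%R ?sqr_ge0//.
  ring.
have -> : \int[m1]_x \int[m2]_t \int[m1]_x' \int[m2]_t' V (x, t) (x', t') =
    I (Q a e).
  rewrite (I_iter (mQ _ _ ma me) (Q0 _ _)).
  apply: eq_integral => x _.
  rewrite (fubini_tonelli (fun q : T2 * T1 => \int[m2]_t' V (x, q.1) (q.2, t')))//.
    apply: (measurable_fun_fubini_tonelli_F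
      (fun z : (T2 * T1) * T2 => V (x, z.1.1) (z.1.2, z.2))) => //.
    apply: mV; apply: measurable_fun_pair => //; exact: measurableT_comp measurable_fst.
  by move=> q; exact: integral_ge0.
have -> : \int[m2]_t \int[m1]_x \int[m1]_x' V (x, t) (x', t) = I (Q a b).
  rewrite (I_iter (mQ _ _ ma mb) (Q0 _ _)).
  have mW : measurable_fun setT
      (fun z : T2 * T1 * T1 => V (z.1.2, z.1.1) (z.2, z.1.1)).
    by apply: mV; apply: measurable_fun_pair => //;
      exact: measurableT_comp measurable_fst.
  rewrite (fubini_tonelli (fun q : T2 * T1 =>
      \int[m1]_x' V (q.2, q.1) (x', q.1)))//; last 2 first.
  - exact: (measurable_fun_fubini_tonelli_F
      (fun z : (T2 * T1) * T1 => V (z.1.2, z.1.1) (z.2, z.1.1))).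
  - by move=> q; exact: integral_ge0.
  apply: eq_integral => x _.
  have mWx : measurable_fun setT (fun q : T2 * T1 => V (x, q.1) (q.2, q.1)).
    by apply: mV; exact: measurable_fun_pair.
  rewrite [LHS](fubini_tonelli _ mWx (fun q => V0 _ _)).
  apply: eq_integral => x' _; apply: eq_integral => t _.
  exact: (esym (int_cst1 m2 (V (x, t) (x', t)))).
have -> : \int[m1]_x \int[m2]_t \int[m2]_t' V (x, t) (x, t') = I (Q a c).
  rewrite (I_iter (mQ _ _ ma mc) (Q0 _ _)).
  apply: eq_integral => x _.
  exact: (esym (int_cst1 m1 (\int[m2]_t \int[m2]_t' V (x, t) (x, t')))).
move: key; rewrite Ebc Ece Ebe -!mule2n.
have mul2 (z : \bar R) : z *+ 2 = 2%:E * z by rewrite mule_natl.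
rewrite !mul2 -ge0_muleDr ?integral_ge0//.
by rewrite lee_pmul2l.
Qed.

End efron_stein.

(** * The Gaussian Poincare inequality on R^d *)

Definition set_coord {R : realType} {d : nat} (t : d.-tuple R) (k : 'I_d) (x : R)
    : d.-tuple R :=
  [tuple if j == k then x else tnth t j | j < d].

Section set_coord.
Context {R : realType}.

Lemma tnth_set_coord d (t : d.-tuple R) k x j :
  tnth (set_coord t k x) j = if j == k then x else tnth t j.
Proof. by rewrite tnth_mktuple. Qed.

Lemma set_coord_cons0 d (t : d.-tuple R) y x :
  set_coord (tuple_cons (y, t)) ord0 x = tuple_cons (x, t).
Proof.
apply: eq_from_tnth => j; rewrite tnth_set_coord.
by have [j' ->|->//] := unliftP ord0 j; rewrite /tuple_cons !tnthS.
Qed.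

Lemma set_coord_consS d (t : d.-tuple R) k y x :
  set_coord (tuple_cons (y, t)) (lift ord0 k) x = tuple_cons (y, set_coord t k x).
Proof.
apply: eq_from_tnth => j; rewrite tnth_set_coord.
have [j' ->|->//] := unliftP ord0 j.
by rewrite (inj_eq lift_inj) /tuple_cons !tnthS tnth_set_coord.
Qed.

End set_coord.

Section gaussian_poincare.
Context {R : realType}.
Variables (s : R) (s0 : 0 < s).
Notation N := (@normal_prob R 0 s).
Notation gauss d := (@gauss_prob R s s0 d).
Local Open Scope ereal_scope.

Let measurable_sqrB d0 (T0 : measurableType d0) (f g : T0 -> R) :
  measurable_fun setT f -> measurable_fun setT g ->
  measurable_fun setT (fun z => ((f z - g z) ^+ 2)%:E).
Proof.
move=> mf mg; apply/measurable_EFinP; apply: measurable_funX.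
exact: measurable_funB.
Qed.

Let measurable_sqr d0 (T0 : measurableType d0) (f : T0 -> R) :
  measurable_fun setT f -> measurable_fun setT (fun z => (f z ^+ 2)%:E).
Proof. by move=> mf; apply/measurable_EFinP; exact: measurable_funX. Qed.

Let sqr_ge0E (x : R) : 0 <= (x ^+ 2)%:E. Proof. by rewrite lee_fin sqr_ge0. Qed.

Lemma gaussian_efron_stein d (f : d.+1.-tuple R -> R) : measurable_fun setT f ->
  \int[gauss d.+1]_p \int[gauss d.+1]_q ((f p - f q) ^+ 2)%:E <=
  \int[gauss d]_t \int[N]_x \int[N]_x'
    ((f (tuple_cons (x, t)) - f (tuple_cons (x', t))) ^+ 2)%:E +
  \int[N]_x \int[gauss d]_t \int[gauss d]_t'
    ((f (tuple_cons (x, t)) - f (tuple_cons (x, t'))) ^+ 2)%:E.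
Proof.
move=> mf; have mfc := measurable_comp_cons mf.
have := efron_stein N (gauss d) mfc.
rewrite [X in X <= _ -> _](_ : _ =
  \int[gauss d.+1]_p \int[gauss d.+1]_q ((f p - f q) ^+ 2)%:E) //.
rewrite ge0_integral_gauss_cons; last 2 first.
- apply: (measurable_fun_fubini_tonelli_F
    (fun z : d.+1.-tuple R * d.+1.-tuple R => ((f z.1 - f z.2) ^+ 2)%:E)) => //.
  apply: measurable_sqrB.
    exact: measurableT_comp mf measurable_fst.
  exact: measurableT_comp mf measurable_snd.
- by move=> t; apply: integral_ge0 => q _; exact: sqr_ge0E.
apply: eq_integral => x _; apply: eq_integral => t _.
rewrite [RHS]ge0_integral_gauss_cons//.
by apply: measurable_sqrB => //; exact: measurable_cst.
Qed.

(** [g k] is the partial derivative of [f] in the direction [k]; only its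
    continuity along that direction is required, which is the form that passes
    to the slices of [f] in the induction on the dimension. *)
Theorem gaussian_poincare d (f : d.-tuple R -> R) (g : 'I_d -> d.-tuple R -> R) :
  measurable_fun setT f -> (forall k, measurable_fun setT (g k)) ->
  (forall k t (x : R), is_derive x 1%R
    (fun u : R^o => f (set_coord t k u) : R^o) (g k (set_coord t k x))) ->
  (forall k t, continuous (fun x : R => g k (set_coord t k x))) ->
  \int[gauss d]_t \int[gauss d]_u ((f t - f u) ^+ 2)%:E <=
  (2 * s ^+ 2)%:E * \sum_(k < d) \int[gauss d]_t (g k t ^+ 2)%:E.
Proof.
have s20 : 0 <= (2 * s ^+ 2)%:E by rewrite lee_fin mulr_ge0 ?sqr_ge0.
elim: d f g => [|d ih] f g mf mg df cg.
  rewrite big_ord0 mule0 integral0_eq// => t _; rewrite integral0_eq// => u _.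
  by rewrite (tuple0 t) (tuple0 u) subrr expr0n.
have mfc := measurable_comp_cons mf.
have mgc k := measurable_comp_cons (mg k).
have mgs (k : 'I_d.+1) : measurable_fun setT (fun t => (g k t ^+ 2)%:E).
  exact: measurable_sqr.
have mgcs k : measurable_fun setT
    (fun p : measurableTypeR R * d.-tuple R => (g k (tuple_cons p) ^+ 2)%:E).
  exact: measurable_sqr.
have G k : \int[gauss d.+1]_t (g k t ^+ 2)%:E =
    \int[N]_x \int[gauss d]_t (g k (tuple_cons (x, t)) ^+ 2)%:E.
  by rewrite ge0_integral_gauss_cons.
apply: (le_trans (gaussian_efron_stein mf)).
rewrite big_ord_recl ge0_muleDr; last 2 first.
- by apply: integral_ge0 => t _; exact: sqr_ge0E.
- by apply: sume_ge0 => k _; apply: integral_ge0 => t _; exact: sqr_ge0E.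
apply: leeD.
  rewrite G (fubini_tonelli (fun p : measurableTypeR R * d.-tuple R =>
     (g ord0 (tuple_cons p) ^+ 2)%:E))//.
  rewrite -ge0_integralZl; [|exact: measurableT| |
    by move=> t _; apply: integral_ge0 => x _; exact: sqr_ge0E|exact: s20]; last first.
    exact: (measurable_fun_fubini_tonelli_G _ (mgcs ord0) (fun=> sqr_ge0E _)).
  apply: ge0_le_integral.
  - exact: measurableT.
  - by move=> t _; do 2! (apply: integral_ge0 => ? _); exact: sqr_ge0E.
  - apply: (measurable_fun_fubini_tonelli_G (fun z : measurableTypeR R * d.-tuple R =>
      \int[N]_x' ((f (tuple_cons z) - f (tuple_cons (x', z.2))) ^+ 2)%:E)).
      apply: (measurable_fun_fubini_tonelli_F
        (fun z : measurableTypeR R * d.-tuple R * measurableTypeR R =>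
           ((f (tuple_cons z.1) - f (tuple_cons (z.2, z.1.2))) ^+ 2)%:E)) => //.
      apply: measurable_sqrB; first exact: measurableT_comp mfc measurable_fst.
      apply: (measurableT_comp mfc); apply: measurable_fun_pair => //.
      exact: measurableT_comp measurable_fst.
    by move=> z; apply: integral_ge0 => t _; exact: sqr_ge0E.
  - apply: emeasurable_funM => //.
    exact: (measurable_fun_fubini_tonelli_G _ (mgcs ord0) (fun=> sqr_ge0E _)).
  move=> t _; apply: gaussian_poincare_line => //.
    move=> u; have := df ord0 (tuple_cons (u, t)) u.
    by rewrite set_coord_cons0; under eq_fun do rewrite set_coord_cons0.
  have := cg ord0 (tuple_cons (0%R, t)).
  by under eq_fun do rewrite set_coord_cons0.
have msum : measurable_fun setT (fun x : R =>
    \sum_(k < d) \int[gauss d]_t (g (lift ord0 k) (tuple_cons (x, t)) ^+ 2)%:E).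
  apply: emeasurable_sum => k.
  exact: (measurable_fun_fubini_tonelli_F _ (mgcs (lift ord0 k)) (fun=> sqr_ge0E _)).
apply: (@le_trans _ _ (\int[N]_x ((2 * s ^+ 2)%:E *
    \sum_(k < d) \int[gauss d]_t (g (lift ord0 k) (tuple_cons (x, t)) ^+ 2)%:E))).
  apply: ge0_le_integral.
  - exact: measurableT.
  - by move=> t _; do 2! (apply: integral_ge0 => ? _); exact: sqr_ge0E.
  - apply: (measurable_fun_fubini_tonelli_F (fun z : measurableTypeR R * d.-tuple R =>
      \int[gauss d]_t' ((f (tuple_cons z) - f (tuple_cons (z.1, t'))) ^+ 2)%:E)).
      apply: (measurable_fun_fubini_tonelli_F
        (fun z : measurableTypeR R * d.-tuple R * d.-tuple R =>
           ((f (tuple_cons z.1) - f (tuple_cons (z.1.1, z.2))) ^+ 2)%:E)) => //.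
      apply: measurable_sqrB; first exact: measurableT_comp mfc measurable_fst.
      apply: (measurableT_comp mfc); apply: measurable_fun_pair => //.
      exact: measurableT_comp measurable_fst.
    by move=> z; apply: integral_ge0 => t _; exact: sqr_ge0E.
  - exact: emeasurable_funM.
  move=> x _; apply: ih.
  - exact: (measurableT_comp mfc (measurable_pair1 x)).
  - by move=> k; exact: (measurableT_comp (mgc _) (measurable_pair1 x)).
  - move=> k t u; have := df (lift ord0 k) (tuple_cons (x, t)) u.
    by rewrite set_coord_consS; under eq_fun do rewrite set_coord_consS.
  - move=> k t; have := cg (lift ord0 k) (tuple_cons (x, t)).
    by under eq_fun do rewrite set_coord_consS.
rewrite ge0_integralZl; [|exact: measurableT|exact: msum| |exact: s20]; last first.
  by move=> x _; apply: sume_ge0 => k _; apply: integral_ge0 => t _; exact: sqr_ge0E.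
rewrite ge0_integral_sum; [|exact: measurableT| |]; last 2 first.
- move=> k; exact: (measurable_fun_fubini_tonelli_F _
    (mgcs (lift ord0 k)) (fun=> sqr_ge0E _)).
- by move=> k x _; apply: integral_ge0 => t _; exact: sqr_ge0E.
by apply: lee_wpmul2l => //; apply: lee_sum => k _; rewrite G.
Qed.

End gaussian_poincare.

Section gaussian_second_moment.
Context {R : realType}.
Variables (s : R) (s0 : 0 < s).
Local Open Scope ereal_scope.

Lemma gauss_second_moment_le d (k : 'I_d) :
  \int[gauss_prob s0 (d := d)]_t (tnth t k ^+ 2)%:E <= (s ^+ 2)%:E.
Proof.
have msq d' (j : 'I_d') :
    measurable_fun setT (fun t : d'.-tuple R => (tnth t j ^+ 2)%:E).
  by apply/measurable_EFinP; apply: measurable_funX; exact: measurable_tnth.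
have sq0 (x : R) : 0 <= (x ^+ 2)%:E by rewrite lee_fin sqr_ge0.
elim: d k => [[]//|d ih k].
rewrite ge0_integral_gauss_cons//.
have [j ->|->] := unliftP ord0 k.
  apply: (@le_trans _ _ (\int[normal_prob 0 s]_x (s ^+ 2)%:E)); last first.
    rewrite integral_cst//.
    by rewrite [X in _ * X](@probability_setT _ _ _ (normal_prob 0 s)) mule1.
  apply: ge0_le_integral => //.
  - by move=> x _; exact: integral_ge0.
  - apply: (measurable_fun_fubini_tonelli_F (fun p : measurableTypeR R * d.-tuple R =>
      (tnth (tuple_cons p) (lift ord0 j) ^+ 2)%:E)) => //.
    exact: measurable_comp_cons (msq _ _).
  - by move=> x _; under eq_integral do rewrite /tuple_cons tnthS; exact: ih.
apply: le_trans (normal_second_moment_le s0).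
rewrite le_eqVlt; apply/orP; left; apply/eqP; apply: eq_integral => x _.
transitivity (\int[gauss_prob s0 (d := d)]_t (cst (x ^+ 2)%:E t)); first by [].
rewrite integral_cst//.
by rewrite [X in _ * X](@probability_setT _ _ _ (gauss_prob s0 (d := d))) mule1.
Qed.

End gaussian_second_moment.

(** * Translated Gaussian measures *)

Section translation.
Context {R : realType}.
Local Open Scope ereal_scope.
Notation leb := (@lebesgue_measure R).

Let mT := measurableTypeR R.

Lemma ge0_integral_lebesgue_translation (a : R) (F : R -> \bar R) :
  measurable_fun setT F -> (forall x, 0 <= F x) ->
  \int[leb]_x F (a + x)%R = \int[leb]_x F x.
Proof.
move=> mF F0; pose f : mT -> mT := fun x : R => (a + x)%R.
have mf : measurable_fun setT f.
  by apply: (@measurable_funD _ _ _ setT (cst a) id).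
pose nu := measure_function_pushforward__canonical__measure_function_Measure leb mf.
have <- : \int[nu]_x F x = \int[leb]_x F x.
  apply: eq_measure_integral => A mA _.
  apply/esym/lebesgue_measure_unique => //= _ [[b c]] _ <-.
  rewrite /pushforward (_ : f @^-1` _ = `](b - a)%R, (c - a)%R]%classic).
    by rewrite !lebesgue_measure_itv/= !lte_fin ltrD2r -!EFinB opprB addrA subrK.
  apply/seteqP; split => x /=; rewrite !in_itv/= /f ltrBlDl lerBrDl//.
by rewrite [RHS](@ge0_integral_pushforward _ _ _ _ R f mf leb setT F)// preimage_setT.
Qed.

Lemma vadd_cons d (a x : R) (b t : d.-tuple R) :
  vadd (tuple_cons (a, b)) (tuple_cons (x, t)) = tuple_cons ((a + x)%R, vadd b t).
Proof.
apply: eq_from_tnth => j; rewrite tnth_mktuple.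
by have [j' ->|->//] := unliftP ord0 j; rewrite /tuple_cons !tnthS tnth_mktuple.
Qed.

Lemma tuple_cons_eta d (a : d.+1.-tuple R) : exists x t, a = tuple_cons (x, t).
Proof. by exists (thead a), [tuple of behead a]; rewrite [LHS]tuple_eta. Qed.

Lemma measurable_vadd d (a : d.-tuple R) : measurable_fun setT (vadd a).
Proof.
apply/measurable_fun_tnthP => k.
rewrite (_ : _ \o _ = fun t => (tnth a k + tnth t k)%R).
  by apply: measurable_funD => //; exact: measurable_tnth.
by apply/funext => t /=; rewrite tnth_mktuple.
Qed.

Lemma measurable_vsub d (a : d.-tuple R) : measurable_fun setT (fun t => vsub t a).
Proof.
apply/measurable_fun_tnthP => k.
rewrite (_ : _ \o _ = fun t => (tnth t k - tnth a k)%R).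
  by apply: measurable_funB => //; exact: measurable_tnth.
by apply/funext => t /=; rewrite tnth_mktuple.
Qed.

Lemma vsub_vadd d (a t : d.-tuple R) : vsub (vadd a t) a = t.
Proof. by apply: eq_from_tnth => k; rewrite !tnth_mktuple addrC addKr. Qed.

Lemma ge0_integral_lebesgue_vec_translation d (a : d.-tuple R)
    (F : d.-tuple R -> \bar R) :
  measurable_fun setT F -> (forall t, 0 <= F t) ->
  \int[@lebesgue_vec R d]_t F (vadd a t) = \int[@lebesgue_vec R d]_t F t.
Proof.
elim: d a F => [a F mF F0|d ih a F mF F0].
  by apply: eq_integral => t _; rewrite (tuple0 (vadd a t)) (tuple0 t).
have [b [c ->]] := tuple_cons_eta a.
have mFa : measurable_fun setT (fun t => F (vadd (tuple_cons (b, c)) t)).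
  exact: measurableT_comp mF (measurable_vadd _).
have mFc := measurable_comp_cons mF.
rewrite (ge0_integral_lebesgue_vec_cons mFa (fun=> F0 _)).
rewrite (ge0_integral_lebesgue_vec_cons mF F0).
pose G (x : R) := \int[@lebesgue_vec R d]_t F (tuple_cons (x, t)).
have mG : measurable_fun setT G.
  exact: (measurable_fun_fubini_tonelli_F _ mFc (fun=> F0 _)).
have G0 x : 0 <= G x by exact: integral_ge0.
rewrite -[RHS](ge0_integral_lebesgue_translation b mG G0).
apply: eq_integral => x _.
pose H (t : d.-tuple R) := F (tuple_cons ((b + x)%R, t)).
transitivity (\int[@lebesgue_vec R d]_t H (vadd c t)).
  by apply: eq_integral => t _; rewrite vadd_cons.
apply: ih => [|t]; last exact: F0.
exact: (measurableT_comp mFc (measurable_pair1 (b + x)%R)).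
Qed.

Lemma ge0_integral_gauss_shift (s : R) (s0 : (0 < s)%R) d (a : d.-tuple R)
    (F : d.-tuple R -> \bar R) :
  measurable_fun setT F -> (forall t, 0 <= F t) ->
  \int[gauss_prob s0 (d := d)]_z F (vadd a z) =
  \int[@lebesgue_vec R d]_t (F t * (gauss_pdf s (vsub t a))%:E).
Proof.
move=> mF F0.
have mFa : measurable_fun setT (fun z => F (vadd a z)).
  exact: measurableT_comp mF (measurable_vadd _).
rewrite (ge0_integral_gauss_prob s0 mFa (fun=> F0 _)).
pose G t := F t * (gauss_pdf s (vsub t a))%:E.
transitivity (\int[@lebesgue_vec R d]_z G (vadd a z)).
  by apply: eq_integral => z _; rewrite /G vsub_vadd.
apply: ge0_integral_lebesgue_vec_translation => [|t].
  apply: emeasurable_funM => //; apply/measurable_EFinP.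
  exact: measurableT_comp (@measurable_gauss_pdf _ _ _) (measurable_vsub _).
by apply: mule_ge0; [exact: F0|rewrite lee_fin gauss_pdf_ge0].
Qed.

End translation.

(** * Fisher information of a Gaussian mixture *)

Lemma sqr_weighted_sum_le (R : realFieldType) (I : finType) (w x : I -> R) :
  (forall i, 0 <= w i) ->
  (\sum_i w i * x i) ^+ 2 <= (\sum_i w i) * \sum_i w i * x i ^+ 2.
Proof.
move=> w0; set W := \sum_i w i; set A := \sum_i w i * x i.
set B := \sum_i w i * x i ^+ 2.
have W0 : 0 <= W by exact: sumr_ge0.
have [W_eq0|W_neq0] := eqVneq W 0.
  have wi0 i : w i = 0.
    by move/eqP : W_eq0; rewrite psumr_eq0// => /allP/(_ i (mem_index_enum _))/eqP.
  by rewrite W_eq0 mul0r /A big1 ?expr0n// => i _; rewrite wi0 mul0r.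
rewrite -subr_ge0 -(pmulr_rge0 _ (_ : 0 < W)); last by rewrite lt0r W_neq0.
(* Up to the factor W, this is the w-variance of x. *)
rewrite (_ : W * (W * B - A ^+ 2) = \sum_i w i * (W * x i - A) ^+ 2).
  by apply: sumr_ge0 => i _; rewrite mulr_ge0// sqr_ge0.
rewrite [RHS](eq_bigr (fun i => W ^+ 2 * (w i * x i ^+ 2) -
  2 * W * A * (w i * x i) + A ^+ 2 * w i)) => [|i _]; last by ring.
by rewrite big_split sumrB/= -!mulr_sumr -/A -/B -/W; ring.
Qed.

Section mixture.
Context {R : realType} {d n : nat}.
Variables (s : R) (s0 : 0 < s) (n_gt0 : (0 < n)%N).
Implicit Types (mu : 'I_n -> d.-tuple R) (t a : d.-tuple R).

Definition mixture_weight mu t := \sum_(i < n) gauss_pdf s (vsub t (mu i)).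

(** The [k]-th component of the gradient of the logarithm of the mixture
    density. *)
Definition mixture_score mu (k : 'I_d) t : R :=
  - (\sum_(i < n) gauss_pdf s (vsub t (mu i)) * (tnth t k - tnth (mu i) k)) /
    (s ^+ 2 * mixture_weight mu t).

Lemma mixture_weight_gt0 mu t : 0 < mixture_weight mu t.
Proof.
rewrite /mixture_weight (bigD1 (Ordinal n_gt0))//= ltr_wpDr ?gauss_pdf_gt0//.
by apply: sumr_ge0 => i _; exact: gauss_pdf_ge0.
Qed.

Lemma mixture_pdfE mu t : mixture_pdf s mu t = n%:R^-1 * mixture_weight mu t.
Proof. by []. Qed.

Lemma mixture_pdf_gt0 mu t : 0 < mixture_pdf s mu t.
Proof. by rewrite mixture_pdfE mulr_gt0 ?mixture_weight_gt0// invr_gt0 ltr0n. Qed.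

Lemma vsub_vaddl a t b : vsub (vadd a t) b = vsub t (vsub b a).
Proof. by apply: eq_from_tnth => k; rewrite !tnth_mktuple; ring. Qed.

Lemma mixture_weight_vadd mu a t :
  mixture_weight mu (vadd a t) = mixture_weight (fun j => vsub (mu j) a) t.
Proof. by apply: eq_bigr => i _; rewrite vsub_vaddl. Qed.

Lemma mixture_pdf_vadd mu a t :
  mixture_pdf s mu (vadd a t) = mixture_pdf s (fun j => vsub (mu j) a) t.
Proof. by rewrite !mixture_pdfE mixture_weight_vadd. Qed.

(** Translating the argument amounts to translating the centres the other way,
    so that properties of the score at [mu_i + z] reduce to properties at [z] of
    another mixture. *)
Lemma mixture_score_vadd mu k a t :
  mixture_score mu k (vadd a t) = mixture_score (fun j => vsub (mu j) a) k t.
Proof.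
rewrite /mixture_score mixture_weight_vadd; congr (- _ / _).
by apply: eq_bigr => i _; rewrite vsub_vaddl !tnth_mktuple; congr (_ * _); ring.
Qed.

Lemma measurable_gauss_pdf_vsub a :
  measurable_fun setT (fun t => gauss_pdf s (vsub t a)).
Proof. exact: measurableT_comp (@measurable_gauss_pdf _ _ _) (measurable_vsub _). Qed.

Lemma measurable_mixture_weight mu : measurable_fun setT (mixture_weight mu).
Proof. by apply: measurable_sum => i; exact: measurable_gauss_pdf_vsub. Qed.

Lemma measurable_mixture_pdf mu : measurable_fun setT (mixture_pdf s mu).
Proof. by apply: measurable_funM => //; exact: measurable_mixture_weight. Qed.

Lemma measurable_ln_mixture mu : measurable_fun setT (fun t => ln (mixture_pdf s mu t)).
Proof. exact: measurableT_comp (@measurable_ln R) (measurable_mixture_pdf _). Qed.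

Lemma measurable_mixture_score mu k : measurable_fun setT (mixture_score mu k).
Proof.
rewrite (_ : mixture_score mu k = fun t =>
   - (\sum_(i < n) gauss_pdf s (vsub t (mu i)) * (tnth t k - tnth (mu i) k)) *
   (s ^+ 2 * mixture_weight mu t) `^ (-1)).
  apply: measurable_funM.
    apply: measurableT_comp => //; apply: measurable_sum => i.
    apply: measurable_funM; first exact: measurable_gauss_pdf_vsub.
    by apply: measurable_funB => //; exact: measurable_tnth.
  apply: (measurableT_comp (measurable_powR _)); apply: measurable_funM => //.
  exact: measurable_mixture_weight.
apply/funext => t; rewrite /mixture_score powR_inv1//.
by rewrite mulr_ge0 ?sqr_ge0 ?ltW ?mixture_weight_gt0.
Qed.

Lemma is_derive_gauss_pdf_set_coord a (k : 'I_d) t (x : R) :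
  is_derive x 1 (fun u : R^o => gauss_pdf s (vsub (set_coord t k u) a) : R^o)
    (- ((x - tnth a k) / s ^+ 2) * gauss_pdf s (vsub (set_coord t k x) a)).
Proof.
pose B := \sum_(j < d | j != k) (tnth t j - tnth a j) ^+ 2.
have E u : \sum_(j < d) tnth (vsub (set_coord t k u) a) j ^+ 2 =
    (u - tnth a k) ^+ 2 + B.
  rewrite (bigD1 k)//= tnth_mktuple tnth_set_coord eqxx; congr (_ + _).
  by apply: eq_bigr => j /negPf jk; rewrite tnth_mktuple tnth_set_coord jk.
rewrite gauss_pdfE E.
under eq_fun do rewrite gauss_pdfE E.
set A := _ `^ _; set c := tnth a k.
have -> : (fun u : R^o => A * expR (- (((u - c) ^+ 2 + B) / (2 * s ^+ 2)))) =
    (A * expR (- (B / (2 * s ^+ 2)))) *: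
      (fun u : R^o => expR ((- (2 * s ^+ 2)^-1) * ((u - c) ^+ 2))).
  apply/funext => u; rewrite ![in RHS]/GRing.scale/= -[RHS]mulrA -expRD.
  by congr (_ * expR _); ring.
apply: is_derive_eq.
rewrite (_ : - (((x - c) ^+ 2 + B) / (2 * s ^+ 2)) =
  - (B / (2 * s ^+ 2)) + (- (2 * s ^+ 2)^-1) * (x - c) ^+ 2); last by ring.
rewrite expRD; set e := expR (- (B / _)); set e' := expR _.
by have s_neq0 := lt0r_neq0 s0; rewrite /GRing.scale/=; field.
Qed.

Lemma is_derive_ln_mixture mu (k : 'I_d) t (x : R) :
  is_derive x 1 (fun u : R^o => ln (mixture_pdf s mu (set_coord t k u)) : R^o)
    (mixture_score mu k (set_coord t k x)).
Proof.
have dS := is_derive_sum (fun i => is_derive_gauss_pdf_set_coord (mu i) k t x).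
have dM : is_derive x 1 (fun u : R^o => mixture_pdf s mu (set_coord t k u) : R^o)
    (n%:R^-1 * \sum_(i < n) (- ((x - tnth (mu i) k) / s ^+ 2) *
       gauss_pdf s (vsub (set_coord t k x) (mu i)))).
  have -> : (fun u : R^o => mixture_pdf s mu (set_coord t k u) : R^o) =
     n%:R^-1 *: (\sum_(i < n)
       (fun u : R^o => gauss_pdf s (vsub (set_coord t k u) (mu i)) : R^o)).
    by apply/funext => u; rewrite /GRing.scale/= fct_sumE.
  exact: (is_deriveZ _ dS).
have dL := is_derive1_ln (mixture_pdf_gt0 mu (set_coord t k x)).
apply: (is_derive_eq (@is_derive1_comp R (@ln R)
  (fun u => mixture_pdf s mu (set_coord t k u)) x _ _ dL dM)).
rewrite mixture_pdfE invfM invrK /mixture_score.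
have W0 := lt0r_neq0 (mixture_weight_gt0 mu (set_coord t k x)).
have n0 : n%:R != 0 :> R by rewrite pnatr_eq0 -lt0n.
rewrite [X in _ * (_ * X)](_ : _ = - (\sum_(i < n)
  gauss_pdf s (vsub (set_coord t k x) (mu i)) *
  (tnth (set_coord t k x) k - tnth (mu i) k)) / s ^+ 2).
  by have s_neq0 := lt0r_neq0 s0; field; rewrite W0 n0 s_neq0.
rewrite -sumrN big_distrl/=; apply: eq_bigr => i _.
by rewrite tnth_set_coord eqxx; ring.
Qed.

Lemma continuous_gauss_pdf_set_coord a (k : 'I_d) t :
  continuous (fun u : R => gauss_pdf s (vsub (set_coord t k u) a)).
Proof.
move=> u; apply: (@differentiable_continuous R R^o R^o); apply/derivable1_diffP.
by have [] := is_derive_gauss_pdf_set_coord a k t u.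
Qed.

Let continuous_sum (F : 'I_n -> R -> R) :
  (forall i, continuous (F i)) -> continuous (fun u => \sum_(i < n) F i u).
Proof.
move=> cF u; rewrite (_ : (fun u => _) = \sum_(i < n) F i); last first.
  by apply/funext => v; rewrite fct_sumE.
elim/big_ind : _ => [|f g cf cg|i _]; [exact: cvg_cst|exact: cvgD|exact: cF].
Qed.

Lemma continuous_mixture_score_set_coord mu (k : 'I_d) t :
  continuous (fun u : R => mixture_score mu k (set_coord t k u)).
Proof.
move=> u; apply: cvgM.
  apply: cvgN; apply: continuous_sum => i v; apply: cvgM.
    exact: continuous_gauss_pdf_set_coord.
  under eq_fun do rewrite tnth_set_coord eqxx.
  rewrite tnth_set_coord eqxx; apply: cvgB; [exact: cvg_id|exact: cvg_cst].
apply: cvgV.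
  by rewrite mulf_neq0 ?expf_neq0 ?lt0r_neq0 ?mixture_weight_gt0.
apply: cvgM; first exact: cvg_cst.
by apply: continuous_sum => i v; exact: continuous_gauss_pdf_set_coord.
Qed.

Lemma mixture_weight_score_le mu k t :
  mixture_score mu k t ^+ 2 * mixture_weight mu t <=
  (s ^+ 4)^-1 * \sum_(i < n)
    (tnth (vsub t (mu i)) k) ^+ 2 * gauss_pdf s (vsub t (mu i)).
Proof.
have W0 := mixture_weight_gt0 mu t.
have := @sqr_weighted_sum_le R 'I_n (fun i => gauss_pdf s (vsub t (mu i)))
  (fun i => tnth t k - tnth (mu i) k) (fun i => gauss_pdf_ge0 _ _).
rewrite -/(mixture_weight mu t) /mixture_score.
under [X in _ -> _ <= _ * X]eq_bigr do rewrite tnth_mktuple mulrC.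
set A := \sum_i _; set B := \sum_i _ => AB.
rewrite (_ : _ * _ = (s ^+ 4)^-1 * (A ^+ 2 / mixture_weight mu t)); last first.
  have := lt0r_neq0 W0; have := lt0r_neq0 s0 => sn Wn.
  by field; rewrite sn Wn.
apply: ler_wpM2l; first by rewrite invr_ge0 exprn_ge0// ltW.
by rewrite ler_pdivrMr// mulrC.
Qed.

(** After the change of variables [t = mu_i + z] the left-hand side is the
    integral of the squared score against the sum of the translated densities.
    The pointwise bound [mixture_weight_score_le] replaces it by [s ^- 4] times
    the sum of the second moments of the components, each at most [s ^ 2] per
    coordinate. *)
Lemma fisher_information_le mu :
  (\sum_(i < n) \sum_(k < d) \int[gauss_prob s0 (d := d)]_z
     (mixture_score mu k (vadd (mu i) z) ^+ 2)%:E <=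
   ((n * d)%:R / s ^+ 2)%:E)%E.
Proof.
rewrite exchange_big/=.
apply: (@le_trans _ _ (\sum_(k < d) (n%:R / s ^+ 2)%:E)%E); last first.
  by rewrite sumEFin lee_fin sumr_const card_ord -mulrnAl -mulrnA.
apply: lee_sum => k _.
pose q t := (mixture_score mu k t ^+ 2)%:E.
have mq : measurable_fun setT q.
  by apply/measurable_EFinP; apply: measurable_funX; exact: measurable_mixture_score.
have q0 t : (0 <= q t)%E by rewrite lee_fin sqr_ge0.
pose r t := ((tnth t k) ^+ 2)%:E : \bar R.
have mr : measurable_fun setT r.
  by apply/measurable_EFinP; apply: measurable_funX; exact: measurable_tnth.
have r0 t : (0 <= r t)%E by rewrite lee_fin sqr_ge0.
have mG (i : 'I_n) : measurable_fun setT (fun t => (gauss_pdf s (vsub t (mu i)))%:E).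
  by apply/measurable_EFinP; exact: measurable_gauss_pdf_vsub.
have G0 (i : 'I_n) t : (0 <= (gauss_pdf s (vsub t (mu i)))%:E)%E.
  by rewrite lee_fin gauss_pdf_ge0.
have mrv (i : 'I_n) : measurable_fun setT (fun t => r (vsub t (mu i))).
  exact: measurableT_comp mr (measurable_vsub _).
have c0 : 0 <= (s ^+ 4)^-1 by rewrite invr_ge0 exprn_ge0// ltW.
have L : (\sum_(i < n) \int[gauss_prob s0 (d := d)]_z q (vadd (mu i) z) =
   \int[@lebesgue_vec R d]_t
     \sum_(i < n) (q t * (gauss_pdf s (vsub t (mu i)))%:E))%E.
  rewrite ge0_integral_sum; [|exact: measurableT| |].
  - by apply: eq_bigr => i _; exact: ge0_integral_gauss_shift.
  - by move=> i; exact: emeasurable_funM mq (mG i).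
  - by move=> i t _; apply: mule_ge0; [exact: q0|exact: G0].
have U : (\sum_(i < n) \int[gauss_prob s0 (d := d)]_z r z =
   \int[@lebesgue_vec R d]_t
     \sum_(i < n) (r (vsub t (mu i)) * (gauss_pdf s (vsub t (mu i)))%:E))%E.
  rewrite ge0_integral_sum; [|exact: measurableT| |].
  - apply: eq_bigr => i _.
    rewrite -(ge0_integral_gauss_shift s0 (mu i) (mrv i) (fun=> r0 _)).
    by apply: eq_integral => z _; rewrite vsub_vadd.
  - by move=> i; exact: emeasurable_funM (mrv i) (mG i).
  - by move=> i t _; apply: mule_ge0; [exact: r0|exact: G0].
have U0 t :
    (0 <= \sum_(i < n) (r (vsub t (mu i)) * (gauss_pdf s (vsub t (mu i)))%:E))%E.
  by apply: sume_ge0 => i _; apply: mule_ge0; [exact: r0|exact: G0].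
have mU : measurable_fun setT (fun t =>
    \sum_(i < n) (r (vsub t (mu i)) * (gauss_pdf s (vsub t (mu i)))%:E))%E.
  by apply: emeasurable_sum => i; exact: emeasurable_funM (mrv i) (mG i).
rewrite -/q [leLHS]L.
apply: (@le_trans _ _ ((s ^+ 4)^-1%:E * \sum_(i < n) (s ^+ 2)%:E)%E); last first.
  rewrite sumEFin -EFinM lee_fin sumr_const card_ord -[_ *+ n]mulr_natr.
  by rewrite le_eqVlt; apply/orP; left; apply/eqP; have := lt0r_neq0 s0 => ?; field.
apply: (@le_trans _ _ ((s ^+ 4)^-1%:E *
    \sum_(i < n) \int[gauss_prob s0 (d := d)]_z r z)%E); last first.
  apply: lee_wpmul2l; first by rewrite lee_fin.
  by apply: lee_sum => i _; exact: gauss_second_moment_le.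
rewrite U -ge0_integralZl_EFin;
  [|exact: measurableT|by move=> t _; exact: U0|exact: mU|exact: c0].
apply: ge0_le_integral.
- exact: measurableT.
- by move=> t _; apply: sume_ge0 => i _; apply: mule_ge0; [exact: q0|exact: G0].
- by apply: emeasurable_sum => i; exact: emeasurable_funM mq (mG i).
- exact: emeasurable_funM.
move=> t _; rewrite /q /r -ge0_sume_distrr; last by move=> i _; exact: G0.
rewrite sumEFin -EFinM.
under [X in (_ <= _ * X)%E]eq_bigr do rewrite -EFinM.
by rewrite sumEFin -EFinM lee_fin; exact: mixture_weight_score_le.
Qed.

Lemma ln_mixture_dispersion_le mu :
  (\sum_(i < n) \int[gauss_prob s0 (d := d)]_z \int[gauss_prob s0 (d := d)]_z'
     ((ln (mixture_pdf s mu (vadd (mu i) z)) -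
       ln (mixture_pdf s mu (vadd (mu i) z'))) ^+ 2)%:E <=
   (2 * (n * d)%:R)%:E)%E.
Proof.
have s20 : (0 <= (2 * s ^+ 2)%:E)%E by rewrite lee_fin mulr_ge0 ?sqr_ge0.
apply: (@le_trans _ _ ((2 * s ^+ 2)%:E *
    \sum_(i < n) \sum_(k < d) \int[gauss_prob s0 (d := d)]_z
     (mixture_score mu k (vadd (mu i) z) ^+ 2)%:E)%E); last first.
  apply: (le_trans (lee_wpmul2l s20 (fisher_information_le mu))).
  rewrite -EFinM lee_fin le_eqVlt; apply/orP; left; apply/eqP.
  by have := lt0r_neq0 s0 => ?; field.
rewrite ge0_sume_distrr; last first.
  move=> i _; apply: sume_ge0 => k _; apply: integral_ge0 => z _.
  by rewrite lee_fin sqr_ge0.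
apply: lee_sum => i _.
pose nu j := vsub (mu j) (mu i).
have Ef : (fun z => ln (mixture_pdf s mu (vadd (mu i) z))) =
    (fun z => ln (mixture_pdf s nu z)).
  by apply/funext => z; rewrite mixture_pdf_vadd.
have Eg : (fun k z => mixture_score mu k (vadd (mu i) z)) = mixture_score nu.
  by apply/funext => k; apply/funext => z; rewrite mixture_score_vadd.
apply: (gaussian_poincare s0 (f := fun z => ln (mixture_pdf s mu (vadd (mu i) z)))
  (g := fun k z => mixture_score mu k (vadd (mu i) z))); rewrite ?Ef ?Eg.
- exact: measurable_ln_mixture.
- by move=> k; have /(congr1 (fun h => h k)) -> := Eg; exact: measurable_mixture_score.
- move=> k t x; rewrite mixture_score_vadd.
  under eq_fun do rewrite mixture_pdf_vadd.
  exact: is_derive_ln_mixture.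
- move=> k t; under eq_fun do rewrite mixture_score_vadd.
  exact: continuous_mixture_score_set_coord.
Qed.

End mixture.

(** * Variance and laws of random variables *)

Section variance_tools.
Local Open Scope ereal_scope.
Context d (T : measurableType d) (R : realType) (P : probability T R).
Implicit Types F G : T -> R.

Lemma Lfun2_sqr F : measurable_fun setT F ->
  \int[P]_x (F x ^+ 2)%:E < +oo -> F \in Lfun P 2%:E.
Proof.
move=> mF Foo; rewrite inE; apply/andP; split; rewrite inE//=.
rewrite /finite_norm unlock /= poweR_lty//.
under eq_integral do rewrite powR_mulrn// real_normK ?num_real//.
exact: Foo.
Qed.

Lemma variance_int F : 'V_P[F] = \int[P]_x ((F x - fine 'E_P[F]) ^+ 2)%:E.
Proof. by rewrite /variance unlock unlock. Qed.

Lemma Lfun2_integrable F : F \in Lfun P 2%:E -> P.-integrable setT (EFin \o F).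
Proof.
by move=> F2; apply/Lfun1_integrable/(Lfun_subset12 _ F2); exact: fin_num_measure.
Qed.

Lemma expectationE F : 'E_P[F] = \int[P]_x (F x)%:E.
Proof. by rewrite unlock. Qed.

Lemma probability_integral_cst (k : \bar R) : \int[P]_x (cst k x) = k.
Proof. by rewrite integral_cst// [X in _ * X](@probability_setT _ _ _ P) mule1. Qed.

Let dispersion F := \int[P]_x \int[P]_y ((F x - F y) ^+ 2)%:E.

(** A finite double integral leaves some [x] for which [F x - F] is square
    integrable, and [F] differs from it by a sign and a constant. *)
Lemma Lfun2_dispersion F : measurable_fun setT F -> dispersion F < +oo ->
  F \in Lfun P 2%:E.
Proof.
move=> mF Doo.
have [[x Hx]|nH] := pselect (exists x, \int[P]_y ((F x - F y) ^+ 2)%:E < +oo).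
  have mG : measurable_fun setT (fun y => F x - F y)%R by exact: measurable_funB.
  have G2 := Lfun2_sqr mG Hx.
  rewrite (_ : F = (cst (F x) \- (fun y => F x - F y))%R).
    by rewrite rpredB//= ?Lfun_cst ?lee1n.
  by apply/funext => y /=; rewrite opprB addrC subrK.
exfalso; move: Doo; rewrite /dispersion (eq_integral (cst +oo)).
  by rewrite probability_integral_cst ltxx.
move=> x _; apply/eqP; rewrite -leye_eq leNgt; apply/negP => h.
by apply: nH; exists x.
Qed.

Lemma dispersionE F : F \in Lfun P 2%:E -> dispersion F = 2%:E * 'V_P[F].
Proof.
move=> F2; have iF := Lfun2_integrable F2.
pose m := fine 'E_P[F]; pose G x := (F x - m)%R.
have mfin : (\int[P]_x (F x)%:E) = m%:E.
  rewrite /m expectationE fineK//; exact: integrable_fin_num.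
have G2 : G \in Lfun P 2%:E.
  by rewrite (_ : G = (F \- cst m)%R)// rpredB//= ?Lfun_cst ?lee1n.
have iG := Lfun2_integrable G2.
have iG2 := Lfun2_integrable_sqr G2.
have VE : 'V_P[F] = \int[P]_x (G x ^+ 2)%:E by rewrite variance_int.
have EG : \int[P]_x (G x)%:E = 0.
  under eq_integral do rewrite EFinB.
  rewrite integralB//; last exact: finite_measure_integrable_cst.
  by rewrite mfin (probability_integral_cst m%:E) subee.
have V0 : 0 <= 'V_P[F] by exact: variance_ge0.
have Vfin : 'V_P[F] \is a fin_num by exact: variance_fin_num.
have inner x : \int[P]_y ((F x - F y) ^+ 2)%:E = (G x ^+ 2)%:E + 'V_P[F].
  rewrite (eq_integral (fun y =>
      ((G x ^+ 2)%:E - (2 * G x)%:E * (G y)%:E) + (G y ^+ 2)%:E)); last first.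
    by move=> y _; rewrite -EFinM -EFinB -EFinD; congr EFin; rewrite /G; ring.
  have i1 : P.-integrable setT (fun y => (2 * G x)%:E * (G y)%:E).
    exact: integrableZl.
  have i2 : P.-integrable setT (cst (G x ^+ 2)%:E).
    exact: finite_measure_integrable_cst.
  rewrite integralD//; last exact: integrableB.
  rewrite integralB// integralZl// EG mule0 sube0 VE.
  by rewrite probability_integral_cst.
rewrite /dispersion; under eq_integral do rewrite inner.
rewrite ge0_integralD//.
- rewrite (probability_integral_cst 'V_P[F]) -VE.
  by rewrite -[2%:E]/((1 + 1)%R%:E) EFinD muleDl// mul1e.
- by move=> x _; rewrite lee_fin sqr_ge0.
- exact: measurable_int iG2.
Qed.

End variance_tools.

Section transfer.
Local Open Scope ereal_scope.
Context dT dT' (T : measurableType dT) (T' : measurableType dT') (R : realType).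
Variables (P : probability T R) (Q : probability T' R) (Z : {RV P >-> T'}).
Hypothesis ZQ : forall A, measurable A -> distribution P Z A = Q A.
Variables (F : T' -> R) (mF : measurable_fun setT F) (F2 : F \in Lfun Q 2%:E).

Lemma ge0_integral_law (G : T' -> \bar R) : measurable_fun setT G ->
  (forall x, 0 <= G x) -> \int[P]_w G (Z w) = \int[Q]_x G x.
Proof.
move=> mG G0; rewrite -(ge0_integral_distribution Z mG G0).
by apply: eq_measure_integral => A mA _; exact: ZQ.
Qed.

Lemma Lfun2_law : (F \o Z) \in Lfun P 2%:E.
Proof.
apply: Lfun2_sqr; first exact: measurableT_comp.
rewrite (@ge0_integral_law (fun x => (F x ^+ 2)%:E)).
- by have /integrable_lty := Lfun2_integrable_sqr F2; exact.
- by apply/measurable_EFinP; exact: measurable_funX.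
- by move=> x; rewrite lee_fin sqr_ge0.
Qed.

Lemma expectation_law : 'E_P[F \o Z] = 'E_Q[F].
Proof.
rewrite !expectationE -(@integral_distribution _ _ _ _ _ P Z (EFin \o F)).
- by apply: eq_measure_integral => A mA _; exact: ZQ.
- exact/measurable_EFinP.
- exact: Lfun2_integrable Lfun2_law.
Qed.

Lemma variance_law : 'V_P[F \o Z] = 'V_Q[F].
Proof.
rewrite !variance_int expectation_law.
rewrite (@ge0_integral_law (fun x => ((F x - fine 'E_Q[F]) ^+ 2)%:E))//.
  by apply/measurable_EFinP; apply: measurable_funX; exact: measurable_funB.
by move=> x; rewrite lee_fin sqr_ge0.
Qed.

End transfer.

(** * Independent random variables are uncorrelated *)

Section uncorrelated.
Local Open Scope ereal_scope.
Context dT d1 (T : measurableType dT) (T1 : measurableType d1) (R : realType).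
Variables (P : probability T R) (Z1 Z2 : {RV P >-> T1}).
Hypothesis indep : forall A B, measurable A -> measurable B ->
  P (Z1 @^-1` A `&` Z2 @^-1` B) = P (Z1 @^-1` A) * P (Z2 @^-1` B).
Variables (F G : T1 -> R).
Hypotheses (mF : measurable_fun setT F) (mG : measurable_fun setT G).
Hypotheses (F2 : (F \o Z1) \in Lfun P 2%:E) (G2 : (G \o Z2) \in Lfun P 2%:E).

Let W w := (Z1 w, Z2 w).

Let mW : measurable_fun setT W.
Proof. by apply: measurable_fun_pair; exact: measurable_funP. Qed.

Let joint := measure_function_pushforward__canonical__measure_function_Measure P mW.

Let law1 : probability T1 R := distribution P Z1.
Let law2 : probability T1 R := distribution P Z2.

(** Independence says that the joint law and the product of the marginals agree
    on rectangles, hence everywhere. *)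
Let jointE A : measurable A -> (law1 \x law2) A = joint A.
Proof.
apply: product_measure_unique => B C mB mC.
exact: indep.
Qed.

Let H (p : T1 * T1) := (F p.1 * G p.2)%:E.

Let mH : measurable_fun setT H.
Proof.
apply/measurable_EFinP; apply: measurable_funM.
  exact: measurableT_comp mF measurable_fst.
exact: measurableT_comp mG measurable_snd.
Qed.

Let iHW : P.-integrable setT (H \o W).
Proof. exact/Lfun1_integrable/(Lfun2_mul_Lfun1 F2 G2). Qed.

Let iH : (law1 \x law2).-integrable setT H.
Proof.
apply/integrableP; split=> //.
rewrite (eq_measure_integral joint) => [|A mA _]; last exact: jointE.
have mabs : measurable_fun setT (fun p => `|H p|) by exact: measurableT_comp.
rewrite [X in X < _](@ge0_integral_pushforward _ _ _ _ R W mW P setT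
  (fun p => `|H p|) measurableT mabs)//.
by rewrite preimage_setT; have /integrableP[] := iHW.
Qed.

Lemma expectation_indep_mul :
  'E_P[(F \o Z1) \* (G \o Z2)] = 'E_P[F \o Z1] * 'E_P[G \o Z2].
Proof.
have iF := Lfun2_integrable F2; have iG := Lfun2_integrable G2.
have eF : \int[law1]_x (F x)%:E = 'E_P[F \o Z1].
  rewrite expectationE; apply: (integral_distribution (X := Z1) (f := EFin \o F)) => //.
  exact/measurable_EFinP.
have eG : \int[law2]_x (G x)%:E = 'E_P[G \o Z2].
  rewrite expectationE; apply: (integral_distribution (X := Z2) (f := EFin \o G)) => //.
  exact/measurable_EFinP.
have fG : 'E_P[G \o Z2] \is a fin_num.
  by rewrite expectationE; exact: integrable_fin_num.
have ilF : law1.-integrable setT (EFin \o F).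
  apply: (integrable_pushforward (phi := Z1)) => //.
  exact/measurable_EFinP.
have ilG : law2.-integrable setT (EFin \o G).
  apply: (integrable_pushforward (phi := Z2)) => //.
  exact/measurable_EFinP.
rewrite expectationE.
transitivity (\int[joint]_p H p).
  by rewrite (integral_pushforward mW mH)// ?preimage_setT.
transitivity (\int[law1 \x law2]_p H p).
  apply: eq_measure_integral => A mA _; exact: (esym (jointE mA)).
rewrite -integral12_prod_meas1//.
transitivity (\int[law1]_x ((F x)%:E * 'E_P[G \o Z2])).
  apply: eq_integral => x _; rewrite /fubini_F /H/=.
  under eq_integral do rewrite EFinM.
  by rewrite integralZl// eG.
by rewrite -(fineK fG) integralZr// eF.
Qed.

Lemma covariance_indep : covariance P (F \o Z1) (G \o Z2) = 0.
Proof.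
have fP : P setT \is a fin_num := fin_num_measure P _ measurableT.
have F1 := Lfun_subset12 fP F2; have G1 := Lfun_subset12 fP G2.
rewrite covarianceE//; last exact: Lfun2_mul_Lfun1.
rewrite expectation_indep_mul subee// fin_numM// expectation_fin_num//.
Qed.

End uncorrelated.

Lemma mutually_independent_pair dT d1 (T : measurableType dT) (T1 : measurableType d1)
    (R : realType) (P : probability T R) (I : finType)
    (Z : I -> {RV P >-> T1}) (i j : I) :
  mutually_independent Z -> i != j ->
  forall A B, measurable A -> measurable B ->
  P (Z i @^-1` A `&` Z j @^-1` B) = (P (Z i @^-1` A) * P (Z j @^-1` B))%E.
Proof.
move=> Zind ij A B mA mB.
(* Only the values at i and j enter; B fills the other indices. *)
have := Zind [set i; j]%SET (fun k => if k == i then A else B).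
rewrite big_setU1 ?inE//= big_set1 eqxx eq_sym (negPf ij) => <- //; last first.
  by move=> k; case: ifP.
congr (P _); apply/seteqP; split => w /=.
  move=> [Aw Bw] k /=; rewrite !inE => /orP[|] /eqP ->; first by rewrite eqxx.
  by rewrite eq_sym (negPf ij).
move=> h; split.
  by have := h i; rewrite /= eqxx; apply; rewrite !inE eqxx.
by have := h j; rewrite /= eq_sym (negPf ij); apply; rewrite !inE eqxx orbT.
Qed.

Section variance_sum.
Local Open Scope ereal_scope.
Context dT (T : measurableType dT) (R : realType) (P : probability T R).
Variables (I : finType) (X : I -> T -> R).
Hypothesis X2 : forall i, X i \in Lfun P 2%:E.
Hypothesis Xcov : forall i j, i != j -> covariance P (X i) (X j) = 0.

Let Lfun2_sum (r : seq I) : (fun w => \sum_(i <- r) X i w)%R \in Lfun P 2%:E.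
Proof.
elim: r => [|i r ih].
  by under eq_fun do rewrite big_nil; exact: Lfun_cst.
rewrite (_ : (fun w => _) = (X i \+ (fun w => \sum_(j <- r) X j w))%R); last first.
  by apply/funext => w; rewrite big_cons.
by rewrite rpredD//= ?lee1n.
Qed.

Lemma Lfun2_sum_fin : (fun w => \sum_i X i w)%R \in Lfun P 2%:E.
Proof. exact: Lfun2_sum. Qed.

Lemma variance_sum_uncorrelated :
  'V_P[(fun w => \sum_i X i w)%R] = \sum_i 'V_P[X i].
Proof.
suff : forall r : seq I, uniq r ->
    'V_P[(fun w => \sum_(i <- r) X i w)%R] = \sum_(i <- r) 'V_P[X i].
  by move=> /(_ (index_enum I)) ->//; exact: index_enum_uniq.
elim=> [_|i r ih /= /andP[ir ur]].
  under eq_fun do rewrite big_nil.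
  by rewrite big_nil (variance_cst P 0%R).
rewrite big_cons -ih//.
rewrite (_ : (fun w => _) = (X i \+ (fun w => \sum_(j <- r) X j w))%R); last first.
  by apply/funext => w; rewrite big_cons.
rewrite varianceD// (_ : covariance P _ _ = 0) ?mule0 ?adde0//.
elim: r ir {ur ih} => [_|j r ih].
  under eq_fun do rewrite big_nil.
  exact: (covariance_cst_r P (X i) 0%R).
rewrite inE negb_or => /andP[ij ir].
rewrite (_ : (fun w => _) = (X j \+ (fun w => \sum_(j <- r) X j w))%R); last first.
  by apply/funext => w; rewrite big_cons.
by rewrite covarianceDr// Xcov// add0e ih.
Qed.

Lemma expectation_sum_fin :
  'E_P[(fun w => \sum_i X i w)%R] = (\sum_i fine 'E_P[X i])%:E.
Proof.
have iX i := Lfun2_integrable (X2 i).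
rewrite expectationE.
under eq_integral do rewrite -sumEFin.
rewrite (integral_sum measurableT (fun i => iX i)) -sumEFin.
apply: eq_bigr => i _; rewrite expectationE fineK//.
exact: (integrable_fin_num measurableT (iX i)).
Qed.

End variance_sum.

(** * The Monte Carlo entropy estimator *)

Section gauss_shift.
Local Open Scope ereal_scope.
Context {R : realType} {d : nat}.
Variables (s : R) (s0 : (0 < s)%R) (a : d.-tuple R).
Variables (F : d.-tuple R -> \bar R) (mF : measurable_fun setT F).
Notation gauss := (gauss_prob s0 (d := d)).
Notation w := (fun t : d.-tuple R => (gauss_pdf s (vsub t a))%:E).

Let w0 t : 0 <= w t. Proof. by rewrite lee_fin gauss_pdf_ge0. Qed.

Let mw : measurable_fun setT w.
Proof. by apply/measurable_EFinP; exact: measurable_gauss_pdf_vsub. Qed.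

Let maxM (x : \bar R) t : maxe (x * w t) 0 = maxe x 0 * w t.
Proof. by rewrite [RHS]muleC maxe_pMr ?gauss_pdf_ge0// mule0 muleC. Qed.

(** The positive and negative parts of [F * w] are those of [F] times [w], since
    [w] is nonnegative. *)
Lemma integral_gauss_shift :
  \int[gauss]_z F (vadd a z) = \int[@lebesgue_vec R d]_t (F t * w t).
Proof.
rewrite integralE [RHS]integralE; congr (_ - _).
  have mp : measurable_fun setT F^\+ by exact: measurable_funepos.
  rewrite (eq_integral (fun z => F^\+ (vadd a z))); last first.
    by move=> z _; rewrite !funeposE.
  rewrite (ge0_integral_gauss_shift s0 a mp (fun=> funepos_ge0 _ _)).
  by apply: eq_integral => t _; rewrite !funeposE maxM.
have mp : measurable_fun setT F^\- by exact: measurable_funeneg.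
rewrite (eq_integral (fun z => F^\- (vadd a z))); last first.
  by move=> z _; rewrite !funenegE.
rewrite (ge0_integral_gauss_shift s0 a mp (fun=> funeneg_ge0 _ _)).
by apply: eq_integral => t _; rewrite !funenegE -maxM mulNe.
Qed.

Lemma integrable_gauss_shift : gauss.-integrable setT (fun z => F (vadd a z)) ->
  (@lebesgue_vec R d).-integrable setT (fun t => F t * w t).
Proof.
move=> /integrableP[_ Foo]; apply/integrableP; split.
  exact: emeasurable_funM mF mw.
have mabs : measurable_fun setT (fun t => `|F t|) by exact: measurableT_comp.
rewrite (ge0_integral_gauss_shift s0 a mabs (fun=> abse_ge0 _)) in Foo.
apply: le_lt_trans Foo.
rewrite le_eqVlt; apply/orP; left; apply/eqP; apply: eq_integral => t _.
by rewrite abseM (gee0_abs (w0 t)).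
Qed.

End gauss_shift.

Section monte_carlo.
Context {R : realType} {d n N : nat}.
Variables (s : R) (s0 : 0 < s) (n_gt0 : (0 < n)%N) (N_gt0 : (0 < N)%N).
Variables (mu : 'I_n -> d.-tuple R).
Notation gauss := (gauss_prob s0 (d := d)).
Notation g := (mixture_pdf s mu).
Let L (i : 'I_n) z := ln (g (vadd (mu i) z)).

Let mL i : measurable_fun setT (L i).
Proof. exact: measurableT_comp (measurable_ln_mixture s mu) (measurable_vadd _). Qed.

Let dispersion i :=
  (\int[gauss]_z \int[gauss]_z' ((L i z - L i z') ^+ 2)%:E)%E.

Let dispersion_ge0 i : (0 <= dispersion i)%E.
Proof. by do 2! (apply: integral_ge0 => ? _); rewrite lee_fin sqr_ge0. Qed.

(** Each dispersion is one term of a sum of nonnegative terms that the Poincare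
    inequality shows to be finite. *)
Lemma Lfun2_ln_mixture i : L i \in Lfun gauss 2%:E.
Proof.
apply: Lfun2_dispersion => //.
apply: (le_lt_trans _ (ltry (2 * (n * d)%:R))).
apply: le_trans (ln_mixture_dispersion_le s0 n_gt0 mu).
rewrite (bigD1 i)//= leeDl//; apply: sume_ge0 => j _; exact: dispersion_ge0.
Qed.

Lemma sum_variance_ln_mixture_le :
  (\sum_(i < n) 'V_(gauss)[L i] <= (n * d)%:R%:E)%E.
Proof.
have h := ln_mixture_dispersion_le s0 n_gt0 mu.
rewrite -(@lee_pmul2l _ 2%:E)// -EFinM; apply: le_trans h.
rewrite ge0_sume_distrr; last by move=> i _; exact: variance_ge0.
by apply: lee_sum => i _; rewrite -dispersionE// Lfun2_ln_mixture.
Qed.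

Let m i := fine ('E_(gauss)[L i]).

Lemma diff_entropy_mixture :
  diff_entropy g = (- (n%:R^-1 * \sum_(i < n) m i))%:E.
Proof.
rewrite EFinN /diff_entropy; congr (- _)%E.
have mlng : measurable_fun setT (fun t => (ln (g t))%:E).
  by apply/measurable_EFinP; exact: measurable_ln_mixture.
have iL i := Lfun2_integrable (Lfun2_ln_mixture i).
have iS i := integrable_gauss_shift (s0 := s0) (a := mu i) mlng (iL i).
transitivity (\int[@lebesgue_vec R d]_t (\sum_(i < n)
    (n%:R^-1%:E * ((ln (g t))%:E * (gauss_pdf s (vsub t (mu i)))%:E))))%E.
  apply: eq_integral => t _.
  under eq_bigr do rewrite -!EFinM.
  rewrite sumEFin; congr EFin; rewrite {1}/mixture_pdf -mulrA mulr_suml mulr_sumr.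
  by apply: eq_bigr => i _; congr (_ * _); exact: mulrC.
rewrite (integral_sum measurableT (fun i => integrableZl measurableT _ (iS i))).
rewrite mulr_sumr -sumEFin; apply: eq_bigr => i _.
rewrite (integralZl measurableT (iS i)) EFinM; congr (_ * _)%E.
rewrite -(integral_gauss_shift s0 (mu i) mlng) /m expectationE fineK//.
exact: (integrable_fin_num measurableT (iL i)).
Qed.

Context dP (T : measurableType dP) (P : probability T R).
Variables (Z : 'I_n * 'I_N -> {RV P >-> d.-tuple R}).
Hypothesis Zind : mutually_independent Z.
Hypothesis Zlaw : forall ij, has_density (Z ij) (gauss_pdf s).

Let X (p : 'I_n * 'I_N) : T -> R := L p.1 \o Z p.

Let Zgauss p A : measurable A -> distribution P (Z p) A = gauss A.
Proof. exact: Zlaw. Qed.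

Let X2 p : X p \in Lfun P 2%:E.
Proof.
exact: (Lfun2_law (Q := gauss) (@Zgauss p) (mL p.1) (Lfun2_ln_mixture p.1)).
Qed.

Let EX p : ('E_P[X p] = 'E_(gauss)[L p.1])%E.
Proof.
exact: (expectation_law (Q := gauss) (@Zgauss p) (mL p.1) (Lfun2_ln_mixture p.1)).
Qed.

Let VX p : ('V_P[X p] = 'V_(gauss)[L p.1])%E.
Proof.
exact: (variance_law (Q := gauss) (@Zgauss p) (mL p.1) (Lfun2_ln_mixture p.1)).
Qed.

Let Xcov p q : p != q -> covariance P (X p) (X q) = 0%E.
Proof.
move=> pq; apply: covariance_indep => //.
- by move=> A B mA mB; exact: mutually_independent_pair.
- exact: X2.
- exact: X2.
Qed.

(** The variance of the average of [n * N] uncorrelated variables is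
    [(n * N)^-2] times the sum of their variances; the variance of the variable
    [(i, j)] depends on [i] alone, so the sum is [N] times a sum which is at
    most [n * d]. *)
Theorem mc_entropy_mse_le :
  (MSE P (fun w => mc_entropy s mu (fun i j => Z (i, j) w)) (diff_entropy g) <=
   (d%:R * (n%:R * N%:R)^-1)%:E)%E.
Proof.
have n0 : n%:R != 0 :> R by rewrite pnatr_eq0 -lt0n.
have N0 : N%:R != 0 :> R by rewrite pnatr_eq0 -lt0n.
pose Y w := \sum_p X p w.
pose c : R := - (n%:R * N%:R)^-1.
have mcE : (fun w => mc_entropy s mu (fun i j => Z (i, j) w)) = (c \o* Y)%R.
  apply/funext => w; rewrite /mc_entropy -mulr_sumr /= /Y /c invfM.
  rewrite (eq_bigr (fun p => X (p.1, p.2) w)) => [|[]//].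
  rewrite -(pair_big xpredT xpredT (fun i j => X (i, j) w))/=.
  by rewrite mulrA mulrN mulrC.
have Y2 : Y \in Lfun P 2%:E by exact: Lfun2_sum_fin.
have cY2 : (c \o* Y)%R \in Lfun P 2%:E by rewrite Lfun_scale// ler1n.
have EY : ('E_P[Y] = (N%:R * \sum_(i < n) m i)%:E)%E.
  rewrite (expectation_sum_fin X2); congr EFin.
  rewrite (eq_bigr (fun p => m p.1)) => [|p _]; last by rewrite EX.
  rewrite -(pair_big xpredT xpredT (fun i j => m i))/=.
  rewrite mulr_sumr; apply: eq_bigr => i _.
  by rewrite sumr_const card_ord mulr_natl.
have EcY : fine ('E_P[(c \o* Y)%R])%E = - (n%:R^-1 * \sum_(i < n) m i).
  rewrite expectationZl ?(Lfun_subset12 _ Y2) ?fin_num_measure//.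
  by rewrite EY /= /c; field; rewrite n0 N0.
have -> : MSE P (fun w => mc_entropy s mu (fun i j => Z (i, j) w))
    (diff_entropy g) = ('V_P[(c \o* Y)%R])%E.
  rewrite variance_int EcY mcE diff_entropy_mixture /MSE.
  by apply: eq_integral => w _; rewrite -EFinB -EFin_expe.
rewrite varianceZ// (variance_sum_uncorrelated X2 Xcov).
have -> : (\sum_p 'V_P[X p] = N%:R%:E * \sum_(i < n) 'V_(gauss)[L i])%E.
  under eq_bigr do rewrite VX.
  rewrite -(pair_big xpredT xpredT (fun i (j : 'I_N) => 'V_(gauss)[L i]))/=.
  rewrite ge0_sume_distrr; last by move=> i _; exact: variance_ge0.
  by apply: eq_bigr => i _; rewrite sumr_const card_ord mule_natl.
apply: (@le_trans _ _ ((c ^+ 2)%:E * (N%:R%:E * (n * d)%:R%:E))%E).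
  apply: lee_wpmul2l; first by rewrite lee_fin sqr_ge0.
  apply: lee_wpmul2l; first by rewrite lee_fin ler0n.
  exact: sum_variance_ln_mixture_le.
rewrite -!EFinM lee_fin le_eqVlt; apply/orP; left; apply/eqP.
by rewrite /c natrM; field; rewrite n0 N0.
Qed.

End monte_carlo.

Theorem theorem5 (R : realType) (d n nMC : nat)
    (hd : (1 <= d)%N) (hn : (1 <= n)%N) (hnMC : (1 <= nMC)%N)
    (sigma : R) (hsigma : 0 < sigma) (mu : 'I_n -> d.-tuple R)
    (dQ : measure_display) (S : measurableType dQ) (Q : probability S R)
    (C : {RV Q >-> d.-tuple R}) (hC : uniform_on mu C)
    (dP : measure_display) (T : measurableType dP) (P : probability T R)
    (Z : 'I_n * 'I_nMC -> {RV P >-> d.-tuple R})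
    (hZind : mutually_independent Z)
    (hZlaw : forall ij, has_density (Z ij) (gauss_pdf sigma)) :
  let g := mixture_pdf sigma mu in
  let hMC := fun w : T => mc_entropy sigma mu (fun i j => Z (i, j) w) in
  ({ae Q, forall s, forall k : 'I_d, -1 <= tnth (C s) k <= 1} ->
    (MSE P hMC (diff_entropy g) <=
      (2 * d%:R * (2 + sigma ^+ 2) / sigma ^+ 2 * (n%:R * nMC%:R)^-1)%:E)%E)
  /\
  (let m := ('E_Q[fun s => (norm2 (C s) ^+ 2)%R])%E in
    (m < +oo)%E ->
    (MSE P hMC (diff_entropy g) <=
      ((9 * d%:R * sigma ^+ 2 + 8 * (2 + sigma * Num.sqrt d%:R) * fine m
        + 3 * (11 * sigma * Num.sqrt d%:R + 1) * Num.sqrt (fine m))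
        / sigma ^+ 2 * (n%:R * nMC%:R)^-1)%:E)%E).
Proof.
move=> g hMC.
have s2 : 0 < sigma ^+ 2 by rewrite exprn_gt0.
have d0 : 0 <= d%:R :> R by [].
have nN0 : 0 <= (n%:R * nMC%:R)^-1 :> R by rewrite invr_ge0 mulr_ge0.
have mse := mc_entropy_mse_le hsigma hn hnMC mu hZind hZlaw.
have ds0 : 0 <= d%:R * sigma ^+ 2 by rewrite mulr_ge0// ltW.
split=> [_|m _]; apply: (le_trans mse); rewrite lee_fin; apply: ler_wpM2r => //;
    rewrite ler_pdivlMr//.
  by rewrite [2 * _ * _]mulrDr; lra.
have m0 : 0 <= fine m by apply/fine_ge0/expectation_ge0 => x; exact: sqr_ge0.
have b0 : 0 <= 8 * (2 + sigma * Num.sqrt d%:R) * fine m.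
  by rewrite !mulr_ge0// addr_ge0// mulr_ge0// ltW.
have c0 : 0 <= 3 * (11 * sigma * Num.sqrt d%:R + 1) * Num.sqrt (fine m).
  by rewrite !mulr_ge0// addr_ge0// !mulr_ge0// ltW.
lra.
Qed.
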